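(* There is a constant $u_0\simeq0.090994609\cdots$ with the following property. Let $\mathbf z\in\mathscr M$ be a non-degenerate zero of $\mathbf f$. If $\mathbf x_0\in\mathscr M$ satisfies $$\tfrac12\,\|\mathbf x_0-\mathbf z\|_{\mathbf z}\,\mu(\mathbf f,\mathbf z)\,\nu(\mathbf z)\le u_0,$$ then the sequence $\mathbf x_{i+1}=\mathbf N_{\mathbf f}(\mathbf x_i)$ is well-defined and $$\|\mathbf x_i-\mathbf z\|_{\mathbf z}\le2^{-2^i+1}\,\|\mathbf x_0-\mathbf z\|_{\mathbf z}.$$
   Context: Spaces. Fix $n\ge1$, finite nonempty sets $A_1,\dots,A_n\subset(\mathbb R^n)^*$ (row vectors), and $\rho_{i,\mathbf a}>0$ for $\mathbf a\in A_i$. $\mathscr F_i$ is the space of exponential sums $f_i(\mathbf x)=\sum_{\mathbf a\in A_i}f_{i,\mathbf a}\rho_{i,\mathbf a}e^{\mathbf a\mathbf x}$ on $\mathbb C^n$, with $(\rho_{i,\mathbf a}e^{\mathbf a\mathbf x})_{\mathbf a\in A_i}$ orthonormal, so $\|f_i\|^2=\sum_{\mathbf a}|f_{i,\mathbf a}|^2$. $V_i(\mathbf x)\in\mathscr F_i^*$ is evaluation at $\mathbf x$; in dual coordinates $V_i(\mathbf x)=(\rho_{i,\mathbf a}e^{\mathbf a\mathbf x})_{\mathbf a}$ and $\|V_i(\mathbf x)\|^2=K_i(\mathbf x,\mathbf x)=\sum_{\mathbf a}\rho_{i,\mathbf a}^2e^{2\mathbf a\,\mathrm{Re}(\mathbf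 x)}$. Let $[V]=([V_1],\dots,[V_n]):\mathbb C^n\to\mathbb P(\mathscr F_1^* )\times\cdots\times\mathbb P(\mathscr F_n^* )$, and let $\mathscr M=\mathbb C^n/[V]$ be the quotient identifying points of $\mathbb C^n$ with the same image under $[V]$. Points of $\mathscr M$ are handled through representatives in $\mathbb C^n$; sums and differences are those of $\mathbb C^n$, and in an expression such as $\|\mathbf x-\mathbf z\|_{\mathbf z}$ the representatives are chosen to minimize the norm. $\mathbf f=(f_1,\dots,f_n)$ with each $f_i\in\mathscr F_i\setminus\{0\}$. Momentum and local norms. $\mathbf m_i(\mathbf x)=\frac12D\log K_i(\mathbf x,\mathbf x)=\sum_{\mathbf a}p_{i,\mathbf a}(\mathbf x)\,\mathbf a$ with $p_{i,\mathbf a}(\mathbf x)=\rho_{i,\mathbf a}^2e^{2\mathbf a\mathrm{Re}(\mathbf x)}/K_i(\mathbf x,\mathbf x)$. $\langle\cdot,\cdot\rangle_{i,\mathbf x}$ is the pull-back by $[V_i]$ of the Fubini–Study metric: $\|\mathbf u\|_{i,\mathbf x}^2=\sum_{\mathbf a}p_{i,\mathbf a}(\mathbf x)|(\mathbf a-\mathbf m_i(\mathbf x))\mathbf u|^2$; $\|\mathbf u\|_{\mathbf x}^2=\sum_{i=1}^n\|\mathbf u\|_{i,\mathbf x}^2$. $T_{\mathbf x}\mathscr M$ is $\mathbb C^n$ (modulo the common kernel of these seminorms, which is $0$ when $DS_{\mathbf f,\mathbf x}(0)$ below is invertible). Newton operator. $S_{\mathbf f,\mathbf x}(\dot{\mathbf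 x})\in\mathbb C^n$ has $i$-th coordinate $\|W_i(\mathbf x)\|^{-1}W_i(\mathbf x+\dot{\mathbf x})(f_i)$, where $W_i(\mathbf y)=e^{-\mathbf m_i(\mathbf x)\mathbf y}V_i(\mathbf y)$ ($\mathbf x$ fixed), so $W_i(\mathbf y)(f_i)=e^{-\mathbf m_i(\mathbf x)\mathbf y}f_i(\mathbf y)$. The Newton operator is $\mathbf N_{\mathbf f}(\mathbf x)=\mathbf x-DS_{\mathbf f,\mathbf x}(0)^{-1}S_{\mathbf f,\mathbf x}(0)$. A non-degenerate zero $\mathbf z$ of $\mathbf f$ is a point with $f_i(\mathbf z)=0$ for all $i$ and $DS_{\mathbf f,\mathbf z}(0)$ invertible. Condition numbers. $\mu(\mathbf f,\mathbf x)=\|DS_{\mathbf f,\mathbf x}(0)^{-1}\,\mathrm{diag}(\|f_1\|,\dots,\|f_n\|)\|_{\mathbf x}$, operator norm from $\mathbb C^n$ (canonical norm) to $(T_{\mathbf x}\mathscr M,\|\cdot\|_{\mathbf x})$. $\nu(\mathbf x)=\max_i\max_{\mathbf a\in A_i}\sup_{\|\mathbf u\|_{i,\mathbf x}\le1}|(\mathbf a-\mathbf m_i(\mathbf x))\mathbf u|$. *)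

(* Defs.v *)
From HB Require Import structures.
From mathcomp Require Import all_boot all_order all_algebra.
From mathcomp Require Import finmap generic_quotient.
From mathcomp Require Import complex.
From mathcomp Require Import all_classical all_reals all_analysis.

Set Implicit Arguments.
Unset Strict Implicit.
Unset Printing Implicit Defensive.

Import Order.TTheory GRing.Theory Num.Theory.
Import numFieldNormedType.Exports.

Local Open Scope classical_set_scope.
Local Open Scope ring_scope.
Local Open Scope complex_scope.
Local Open Scope quotient_scope.

(* The library puts the norm topology on [K^o] for a numFieldType [K]; this
   transports it to [R[i]], and hence to its matrices. *)
HB.instance Definition _ (R : realType) :=
  NormedModule.copy R[i] (R[i] : numFieldType)^o.

Section Complex.
Context {R : realType}.

Definition cabs (w : R[i]) : R := ComplexField.Normc.normc w.

Definition cexp (w : R[i]) : R[i] :=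
  (expR (complex.Re w))%:C * (cos (complex.Im w) +i* sin (complex.Im w)).

(* Hermitian norm of a finite family of complex numbers: the norm of C^n, and
   the norm of F_i and of its dual in orthonormal coordinates. *)
Definition hnorm (T : finType) (v : T -> R[i]) : R :=
  Num.sqrt (\sum_t cabs (v t) ^+ 2).

Definition rowcol n (a : 'rV[R]_n) (u : 'cV[R[i]]_n) : R[i] :=
  \sum_j (a 0 j)%:C * u j 0.

End Complex.

(* An exponential sum
     f_i(x) = \sum_(a in A_i) f_(i,a) rho_(i,a) e^(a x)
   is given by its coordinates f_(i,a) in the orthonormal basis
   (rho_(i,a) e^(a x))_a, so that F_i is {ffun A i -> R[i]}; elements of the
   dual are given by their dual coordinates. *)
Section ExponentialSums.
Context {R : realType} {n : nat} {A : 'I_n -> {fset 'rV[R]_n}}.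
Variable rho : forall i, A i -> R.
Implicit Types (i : 'I_n) (x y z u : 'cV[R[i]]_n).

Definition evalV i x : {ffun A i -> R[i]} :=
  [ffun a => (rho a)%:C * cexp (rowcol (val a) x)].

Definition dual_app i (w f : {ffun A i -> R[i]}) : R[i] :=
  \sum_a f a * w a.

Definition same_image x y : bool :=
  `[< forall i, exists2 l : R[i], l != 0 &
        forall a, evalV i x a = l * evalV i y a >].

Lemma same_image_refl : reflexive same_image.
Proof.
by move=> x; apply/asboolP => i; exists 1; rewrite ?oner_neq0// => a; rewrite mul1r.
Qed.

Lemma same_image_sym : symmetric same_image.
Proof.
suff H x y : same_image x y -> same_image y x by move=> x y; apply/idP/idP; apply: H.
move=> /asboolP xy; apply/asboolP => i; have [l l0 h] := xy i.
by exists l^-1; rewrite ?invr_eq0// => a; rewrite h mulKf.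
Qed.

Lemma same_image_trans : transitive same_image.
Proof.
move=> y x z /asboolP xy /asboolP yz; apply/asboolP => i.
have [l l0 h] := xy i; have [k k0 g] := yz i.
by exists (l * k); rewrite ?mulf_neq0// => a; rewrite h g mulrA.
Qed.

Canonical same_image_equiv :=
  EquivRel same_image same_image_refl same_image_sym same_image_trans.

Definition toric := {eq_quot same_image}.
HB.instance Definition _ := EqQuotient.on toric.

Definition kernelK i x : R :=
  \sum_(a : A i) rho a ^+ 2 * expR (2 * complex.Re (rowcol (val a) x)).

Definition prob i x (a : A i) : R :=
  rho a ^+ 2 * expR (2 * complex.Re (rowcol (val a) x)) / kernelK i x.

Definition momentum i x : 'rV[R]_n := \sum_(a : A i) prob x a *: val a.

Definition lnorm_i i x u : R :=
  Num.sqrt (\sum_(a : A i)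
    prob x a * cabs (rowcol (val a - momentum i x) u) ^+ 2).

Definition lnorm x u : R := Num.sqrt (\sum_i lnorm_i i x u ^+ 2).

(* The distance written || x - z ||_z for x and z in the quotient: the norm is
   minimized over the representatives of both points.  When the seminorm at z
   is a norm, the identified points differ by a discrete group of translations
   and the infimum is attained. *)
Definition toric_dist (x z : toric) : R :=
  inf [set r | exists x' z', [/\ \pi_toric x' = x, \pi_toric z' = z &
                                 r = lnorm z' (x' - z')]].

Definition nu x : R :=
  \big[Num.max/0]_(i < n) \big[Num.max/0]_(a : A i)
    sup [set r | exists2 u, lnorm_i i x u <= 1 &
                            r = cabs (rowcol (val a - momentum i x) u)].

Section Newton.
Variable f : forall i, {ffun A i -> R[i]}.

(* The momentum is taken at the base point x, not at y. *)
Definition renormW x i y : {ffun A i -> R[i]} :=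
  [ffun a => cexp (- rowcol (momentum i x) y) * evalV i y a].

Definition newtonS x (dx : 'cV[R[i]]_n) : 'cV[R[i]]_n :=
  \col_i ((hnorm (renormW x i x))^-1%:C * dual_app (renormW x i (x + dx)) (f i)).

(* Matrix, acting on columns, of the complex differential at 0. *)
Definition newtonDS x : 'M[R[i]]_n :=
  \matrix_(i, j) ('d (newtonS x) (0 : 'cV[R[i]]_n)) (delta_mx j 0) i 0.

Definition newton x : 'cV[R[i]]_n := x - invmx (newtonDS x) *m newtonS x 0.

Definition nondegenerate_zero z : Prop :=
  (forall i, dual_app (evalV i z) (f i) = 0) /\ newtonDS z \in unitmx.

(* The Newton operator is defined at the point x of the quotient and maps it
   to y, whatever the representative of x. *)
Definition newton_step (x y : toric) : Prop :=
  forall x', \pi_toric x' = x ->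
    newtonDS x' \in unitmx /\ \pi_toric (newton x') = y.

Definition mu x : R :=
  sup [set r | exists2 w : 'cV[R[i]]_n, hnorm (fun i => w i 0) <= 1 &
    r = lnorm x
          (invmx (newtonDS x) *m (diag_mx (\row_i (hnorm (f i))%:C) *m w))].

End Newton.
End ExponentialSums.

(* Main.v *)
(* With m_i = m_i(z), L_a(u) = (a - m_i) u and x = z + h, dividing the i-th row
   of the Newton system at x by a nonzero scalar turns it into
     sum_a g_a e^(L_a(h)) (L_a(u) - (m_i(x) - m_i(z)) u),
   where the coefficients satisfy sum_a g_a = 0 and |g_a| = |f_(i,a)| sqrt(p_a).
   Hence it differs from the row at z, sum_a g_a L_a(u), by terms which
   Cauchy-Schwarz bounds by ||f_i|| ||u||_(i,z) times a multiple of
   v = nu(z) ||h||_z, since |L_a(h)| <= v.  The new error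
   N(x) - z solves this system with a right-hand side of second order in h,
   bounded in the same way.  As the inverse of the matrix at z costs a factor
   mu(f,z) >= 1, the new error is at most
   2.745 mu nu ||h||_z^2 when mu nu ||h||_z <= 0.182, and 2.745 * 0.182 < 1/2.
   Everything is invariant under change of representatives; the infimum in the
   distance need not be attained, so the bound is proved for representatives
   within epsilon of it, and epsilon tends to 0. *)
Require Import Defs.
From HB Require Import structures.
From mathcomp Require Import all_boot all_order all_algebra.
From mathcomp Require Import finmap generic_quotient.
From mathcomp Require Import complex.
From mathcomp Require Import all_classical all_reals all_analysis.
From mathcomp Require Import ring lra.

Set Implicit Arguments.
Unset Strict Implicit.
Unset Printing Implicit Defensive.

Import Order.TTheory GRing.Theory Num.Theory.
Import numFieldNormedType.Exports.

Local Open Scope ring_scope.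
Local Open Scope complex_scope.
Local Open Scope quotient_scope.

(** * Modulus and complex exponential: first- and second-order estimates *)

Section ComplexExponential.
Context {R : realType}.
Implicit Types (w : R[i]) (t : R).

Lemma cabs_ge0 w : 0 <= cabs w.
Proof. by case: w => a b; exact: sqrtr_ge0. Qed.

Lemma cabs0 : cabs (0 : R[i]) = 0.
Proof. exact: ComplexField.Normc.normc0. Qed.

Lemma cabs1 : cabs (1 : R[i]) = 1.
Proof. exact: ComplexField.Normc.normc1. Qed.

Lemma cabsM w w' : cabs (w * w') = cabs w * cabs w'.
Proof. exact: ComplexField.Normc.normcM. Qed.

Lemma cabsV w : cabs w^-1 = (cabs w)^-1.
Proof. exact: ComplexField.Normc.normcV. Qed.

Lemma cabsD w w' : cabs (w + w') <= cabs w + cabs w'.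
Proof. exact: le_normcD. Qed.

Lemma cabsN w : cabs (- w) = cabs w.
Proof. exact: normcN. Qed.

Lemma cabsB w w' : cabs (w - w') <= cabs w + cabs w'.
Proof. by rewrite -[cabs w']cabsN cabsD. Qed.

Lemma cabsR t : cabs t%:C = `|t|.
Proof. by rewrite /cabs /= expr0n addr0 sqrtr_sqr. Qed.

Lemma cabs_eq0 w : (cabs w == 0) = (w == 0).
Proof.
by apply/eqP/eqP => [/ComplexField.Normc.eq0_normc//|->]; rewrite cabs0.
Qed.

Lemma cabs_sum (T : finType) (F : T -> R[i]) :
  cabs (\sum_t F t) <= \sum_t cabs (F t).
Proof.
elim/big_ind2 : _ => [|x y x' y' hx hy|//]; first by rewrite cabs0.
by rewrite (le_trans (cabsD _ _))// lerD.
Qed.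

Lemma sqr_cabs w : cabs w ^+ 2 = complex.Re w ^+ 2 + complex.Im w ^+ 2.
Proof. by case: w => a b /=; rewrite sqr_sqrtr// addr_ge0 ?sqr_ge0. Qed.

Lemma normr_Re_le w : `|complex.Re w| <= cabs w.
Proof.
rewrite -(ler_pXn2r (n := 2)) ?nnegrE ?normr_ge0 ?cabs_ge0//.
by rewrite sqr_cabs real_normK ?num_real// lerDl sqr_ge0.
Qed.

Lemma normc_cabs w : `|w| = (cabs w)%:C.
Proof. by case: w => a b; rewrite normc_def. Qed.

Lemma cexpD w w' : cexp (w + w') = cexp w * cexp w'.
Proof.
case: w w' => a b [c d]; rewrite /cexp /= expRD cosD sinD.
by apply/eqP; rewrite eq_complex /=; apply/andP; split; apply/eqP; ring.
Qed.

Lemma cexp0 : cexp (0 : R[i]) = 1.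
Proof. by rewrite /cexp /= expR0 cos0 sin0 mul1r. Qed.

Lemma cexpR t : cexp t%:C = (expR t)%:C.
Proof.
rewrite /cexp /= cos0 sin0; apply/eqP.
by rewrite eq_complex /=; apply/andP; split; apply/eqP; ring.
Qed.

Lemma cabs_cexp w : cabs (cexp w) = expR (complex.Re w).
Proof.
rewrite cabsM cabsR ger0_norm ?expR_ge0//.
by rewrite /cabs /= cos2Dsin2 sqrtr1 mulr1.
Qed.

Lemma cexp_neq0 w : cexp w != 0.
Proof. by rewrite -cabs_eq0 cabs_cexp gt_eqF// expR_gt0. Qed.

(* Projecting the path [(A, B)] on the direction of its total displacement
   reduces the planar inequality to the real mean value theorem. *)
Lemma planar_mean_value (A B A' B' : R -> R) (K : R) :
  (forall t, is_derive t 1 A (A' t)) -> (forall t, is_derive t 1 B (B' t)) ->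
  (forall t, 0 <= t <= 1 -> A' t ^+ 2 + B' t ^+ 2 <= K) ->
  (A 1 - A 0) ^+ 2 + (B 1 - B 0) ^+ 2 <= K.
Proof.
move=> dA dB hK; set p := A 1 - A 0; set q := B 1 - B 0.
pose psi := p *: A + q *: B.
have dpsi t : is_derive t 1 psi (p *: A' t + q *: B' t).
  by apply: is_deriveD; apply: is_deriveZ.
have [|c c01] := @MVT_segment _ psi _ 0 1 ler01 (fun t _ => dpsi t).
  apply: continuous_subspaceT => t; apply: differentiable_continuous.
  by apply/derivable1_diffP; apply: ex_derive.
rewrite /psi !fctE subr0 mulr1 /GRing.scale /= => E.
have {}hK : A' c ^+ 2 + B' c ^+ 2 <= K by apply: hK; move: c01; rewrite in_itv.
have {}E : p ^+ 2 + q ^+ 2 = p * A' c + q * B' c.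
  by rewrite -E /p /q; ring.
have h0 : 0 <= p ^+ 2 + q ^+ 2 by rewrite addr_ge0 ?sqr_ge0.
have CS : (p ^+ 2 + q ^+ 2) ^+ 2 <= (p ^+ 2 + q ^+ 2) * K.
  rewrite [X in X ^+ 2 <= _]E.
  apply: le_trans (_ : (p ^+ 2 + q ^+ 2) * (A' c ^+ 2 + B' c ^+ 2) <= _); last first.
    exact: ler_wpM2l.
  rewrite -subr_ge0 [X in 0 <= X](_ : _ = (p * B' c - q * A' c) ^+ 2) ?sqr_ge0//.
  by ring.
have [->|D0] := eqVneq (p ^+ 2 + q ^+ 2) 0.
  by apply: le_trans hK; rewrite addr_ge0 ?sqr_ge0.
by rewrite -(ler_pM2l (x := p ^+ 2 + q ^+ 2)) ?lt_neqAle 1?eq_sym ?D0// -expr2.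
Qed.

Section ExponentialPath.
Variables x y : R.

Let A (t : R) := expR (t * x) * cos (t * y).
Let B (t : R) := expR (t * x) * sin (t * y).

Let dmul (z t : R) : is_derive t 1 (fun s : R => s * z) z.
Proof.
have -> : (fun s : R => s * z) = z *: (id : R -> R).
  by apply/funext => s; rewrite fctE /GRing.scale /= mulrC.
by apply: is_derive_eq; rewrite /GRing.scale /= mulr1.
Qed.

Let dA t : is_derive t 1 A (x * A t - y * B t).
Proof.
have dE : is_derive t 1 (fun s => expR (s * x)) (x * expR (t * x)).
  rewrite mulrC; exact: (@is_derive1_comp _ expR (fun s : R => s * x)).
have dC : is_derive t 1 (fun s => cos (s * y)) (y * - sin (t * y)).
  rewrite mulrC; exact: (@is_derive1_comp _ cos (fun s : R => s * y)).
apply: (is_derive_eq (is_deriveM dE dC)).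
by rewrite /GRing.scale /= /A /B; ring.
Qed.

Let dB t : is_derive t 1 B (x * B t + y * A t).
Proof.
have dE : is_derive t 1 (fun s => expR (s * x)) (x * expR (t * x)).
  rewrite mulrC; exact: (@is_derive1_comp _ expR (fun s : R => s * x)).
have dS : is_derive t 1 (fun s => sin (s * y)) (y * cos (t * y)).
  rewrite mulrC; exact: (@is_derive1_comp _ sin (fun s : R => s * y)).
apply: (is_derive_eq (is_deriveM dE dS)).
by rewrite /GRing.scale /= /A /B; ring.
Qed.

Let sqrAB t : A t ^+ 2 + B t ^+ 2 = expR (t * x) ^+ 2.
Proof. by rewrite /A /B !exprMn -mulrDr cos2Dsin2 mulr1. Qed.

Let expR_le t (c : R) : 0 <= t <= 1 -> `|x| <= c -> expR (t * x) <= expR c.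
Proof.
case/andP => t0 t1 xc; rewrite ler_expR (le_trans (ler_norm _))//.
rewrite normrM ger0_norm// (le_trans _ xc)// ler_piMl//.
Qed.

(** With w = x + iy, the pair [(A, B)] is the path e^(tw) from 1 to e^w, whose speed |w| e^(tx) is
    at most |w| e^c on [0, 1]. *)
Lemma sqr_cexp_sub1_le (c : R) : `|x| <= c ->
  (expR x * cos y - 1) ^+ 2 + (expR x * sin y) ^+ 2
  <= (x ^+ 2 + y ^+ 2) * expR c ^+ 2.
Proof.
move=> xc; have := planar_mean_value dA dB.
rewrite /A /B !mul1r !mul0r expR0 cos0 sin0 mulr1 mulr0 subr0; apply=> t t01.
rewrite [leLHS](_ : _ = (x ^+ 2 + y ^+ 2) * (A t ^+ 2 + B t ^+ 2)); last by rewrite /A /B; ring.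
rewrite sqrAB ler_wpM2l ?addr_ge0 ?sqr_ge0//.
by rewrite ler_pXn2r ?nnegrE ?expR_ge0// expR_le.
Qed.

(** Here the path is (tw - 1) e^(tw): its increment over [0, 1] is w e^w - e^w + 1, and its
    derivative t w^2 e^(tw) is already quadratic in w. *)
Lemma sqr_cexp_taylor_le (c : R) : `|x| <= c ->
  (expR x * ((x - 1) * cos y - y * sin y) + 1) ^+ 2
    + (expR x * ((x - 1) * sin y + y * cos y)) ^+ 2
  <= (x ^+ 2 + y ^+ 2) ^+ 2 * expR c ^+ 2.
Proof.
move=> xc.
pose A2 t := (t * x - 1) * A t - (t * y) * B t.
pose B2 t := (t * x - 1) * B t + (t * y) * A t.
have dx t : is_derive t 1 (fun s => s * x - 1) x.
  have d1 : is_derive t 1 (cst 1 : R -> R) 0 by exact: is_derive_cst.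
  by apply: (is_derive_eq (is_deriveB (dmul x t) d1)); rewrite subr0.
have dA2 t : is_derive t 1 A2 (t * ((x ^+ 2 - y ^+ 2) * A t - (2 * x * y) * B t)).
  apply: (is_derive_eq (is_deriveB (is_deriveM (dx t) (dA t)) (is_deriveM (dmul y t) (dB t)))).
  by rewrite /GRing.scale /=; ring.
have dB2 t : is_derive t 1 B2 (t * ((x ^+ 2 - y ^+ 2) * B t + (2 * x * y) * A t)).
  apply: (is_derive_eq (is_deriveD (is_deriveM (dx t) (dB t)) (is_deriveM (dmul y t) (dA t)))).
  by rewrite /GRing.scale /=; ring.
have /(_ ((x ^+ 2 + y ^+ 2) ^+ 2 * expR c ^+ 2)) := planar_mean_value dA2 dB2.
have -> : A2 1 - A2 0 = expR x * ((x - 1) * cos y - y * sin y) + 1.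
  by rewrite /A2 /A /B !mul1r !mul0r expR0 cos0; ring.
have -> : B2 1 - B2 0 = expR x * ((x - 1) * sin y + y * cos y).
  by rewrite /B2 /A /B !mul1r !mul0r sin0; ring.
apply=> t t01; have [t0 t1] := andP t01.
rewrite [leLHS](_ : _ = t ^+ 2 * ((x ^+ 2 + y ^+ 2) ^+ 2 * (A t ^+ 2 + B t ^+ 2))); last by ring.
rewrite sqrAB.
apply: (@le_trans _ _ (1 * ((x ^+ 2 + y ^+ 2) ^+ 2 * expR (t * x) ^+ 2))).
  by apply: ler_wpM2r; [rewrite mulr_ge0 ?sqr_ge0|exact: exprn_ile1].
rewrite mul1r ler_wpM2l ?sqr_ge0//.
by rewrite ler_pXn2r ?nnegrE ?expR_ge0// expR_le.
Qed.

End ExponentialPath.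

Let cabs_le w (K : R) : 0 <= K -> cabs w ^+ 2 <= K ^+ 2 -> cabs w <= K.
Proof. by move=> K0; rewrite ler_pXn2r ?nnegrE ?cabs_ge0. Qed.

Lemma cabs_cexp_sub1 w (c : R) : cabs w <= c ->
  cabs (cexp w - 1) <= expR c * cabs w.
Proof.
move=> wc; apply: cabs_le; first by rewrite mulr_ge0 ?expR_ge0 ?cabs_ge0.
rewrite exprMn [X in _ <= _ * X]sqr_cabs [leRHS]mulrC.
have xc := le_trans (normr_Re_le w) wc.
apply: le_trans (sqr_cexp_sub1_le _ xc).
by case: w {wc xc} => x y; rewrite sqr_cabs /= !mul0r subr0 addr0 oppr0 addr0.
Qed.

Lemma cabs_cexp_taylor w (c : R) : cabs w <= c ->
  cabs (cexp w * w - cexp w + 1) <= expR c * cabs w ^+ 2.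
Proof.
move=> wc; apply: cabs_le; first by rewrite mulr_ge0 ?expR_ge0 ?sqr_ge0.
rewrite exprMn [X in _ <= _ * X ^+ 2]sqr_cabs [leRHS]mulrC.
have xc := le_trans (normr_Re_le w) wc.
apply: le_trans (sqr_cexp_taylor_le _ xc).
case: w {wc xc} => x y; rewrite sqr_cabs /=.
by rewrite le_eqVlt; apply/orP; left; apply/eqP; ring.
Qed.

End ComplexExponential.

(** * Cauchy-Schwarz and Minkowski inequalities for finite families *)

Section EuclideanNorm.
Context {R : realType} {T : finType}.
Implicit Types (x y : T -> R).

Lemma sqrt_sum_cauchy_schwarz x y :
  \sum_t x t * y t <= Num.sqrt (\sum_t x t ^+ 2) * Num.sqrt (\sum_t y t ^+ 2).
Proof.
have X0 : 0 <= \sum_t x t ^+ 2 by apply: sumr_ge0 => t _; exact: sqr_ge0.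
have Y0 : 0 <= \sum_t y t ^+ 2 by apply: sumr_ge0 => t _; exact: sqr_ge0.
rewrite -sqrtrM// (le_trans (ler_norm _))// -sqrtr_sqr ler_wsqrtr//.
rewrite -subr_ge0 -(pmulr_rge0 (x := 2))//.
(* Lagrange's identity: twice the Cauchy-Schwarz defect is a sum of squares over all pairs of
   indices. *)
rewrite [leRHS](_ : _ = \sum_s \sum_t (x s * y t - x t * y s) ^+ 2).
  by apply: sumr_ge0 => s _; apply: sumr_ge0 => t _; exact: sqr_ge0.
transitivity (\sum_s \sum_t (x s ^+ 2 * y t ^+ 2 + y s ^+ 2 * x t ^+ 2
                             - 2 * (x s * y s) * (x t * y t))).
  have E (u v : T -> R) : \sum_s \sum_t u s * v t = (\sum_t u t) * (\sum_t v t).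
    by rewrite mulr_suml; apply: eq_bigr => s _; rewrite mulr_sumr.
  under [RHS]eq_bigr do rewrite sumrB big_split /=.
  rewrite sumrB big_split /= !E -mulr_sumr; ring.
by apply: eq_bigr => s _; apply: eq_bigr => t _; ring.
Qed.

Lemma sqrt_sumD x y :
  Num.sqrt (\sum_t (x t + y t) ^+ 2)
  <= Num.sqrt (\sum_t x t ^+ 2) + Num.sqrt (\sum_t y t ^+ 2).
Proof.
have X0 : 0 <= \sum_t x t ^+ 2 by apply: sumr_ge0 => t _; exact: sqr_ge0.
have Y0 : 0 <= \sum_t y t ^+ 2 by apply: sumr_ge0 => t _; exact: sqr_ge0.
rewrite -[leRHS]ger0_norm ?addr_ge0 ?sqrtr_ge0// -sqrtr_sqr ler_wsqrtr//.
rewrite sqrrD !sqr_sqrtr// -mulr_natl.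
have -> : \sum_t (x t + y t) ^+ 2
    = \sum_t x t ^+ 2 + 2 * (\sum_t x t * y t) + \sum_t y t ^+ 2.
  by rewrite mulr_sumr -!big_split /=; apply: eq_bigr => t _; ring.
by rewrite lerD2r lerD2l ler_pM2l// sqrt_sum_cauchy_schwarz.
Qed.

Lemma sqrt_sumZ (c : R) x : 0 <= c ->
  Num.sqrt (\sum_t (c * x t) ^+ 2) = c * Num.sqrt (\sum_t x t ^+ 2).
Proof.
move=> c0; rewrite -[c in RHS]ger0_norm// -sqrtr_sqr -sqrtrM ?sqr_ge0//.
by rewrite mulr_sumr; congr Num.sqrt; apply: eq_bigr => t _; rewrite exprMn.
Qed.

Lemma ler_sqrt_sum x y : (forall t, 0 <= x t <= y t) ->
  Num.sqrt (\sum_t x t ^+ 2) <= Num.sqrt (\sum_t y t ^+ 2).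
Proof.
move=> xy; rewrite ler_wsqrtr// ler_sum// => t _; have /andP[x0 xyt] := xy t.
by rewrite ler_pXn2r ?nnegrE// (le_trans x0).
Qed.

End EuclideanNorm.

(** * Seminorms weighted by a probability vector *)

Section WeightedNorm.
Context {R : realType} {T : finType}.
Variable p : T -> R.
Hypothesis p_ge0 : forall t, 0 <= p t.
Implicit Types (l : T -> R[i]).

Definition wnorm l : R := Num.sqrt (\sum_t p t * cabs (l t) ^+ 2).

Lemma wnorm_ge0 l : 0 <= wnorm l.
Proof. exact: sqrtr_ge0. Qed.

Lemma wnormE l : wnorm l = Num.sqrt (\sum_t (Num.sqrt (p t) * cabs (l t)) ^+ 2).
Proof.
by congr Num.sqrt; apply: eq_bigr => t _; rewrite exprMn sqr_sqrtr.
Qed.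

Lemma ler_wnorm l l' (c : R) : 0 <= c -> (forall t, cabs (l t) <= c * cabs (l' t)) ->
  wnorm l <= c * wnorm l'.
Proof.
move=> c0 ll'; rewrite !wnormE -sqrt_sumZ//; apply: ler_sqrt_sum => t.
by rewrite mulr_ge0 ?cabs_ge0 ?sqrtr_ge0//= mulrCA ler_wpM2l ?sqrtr_ge0.
Qed.

Lemma cabs_le_wnorm l t : Num.sqrt (p t) * cabs (l t) <= wnorm l.
Proof.
rewrite wnormE -[leLHS]ger0_norm ?mulr_ge0 ?cabs_ge0 ?sqrtr_ge0//.
rewrite -sqrtr_sqr ler_wsqrtr// (bigD1 t)//= lerDl.
by apply: sumr_ge0 => s _; exact: sqr_ge0.
Qed.

Lemma wnorm_dot l l' : \sum_t p t * (cabs (l t) * cabs (l' t)) <= wnorm l * wnorm l'.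
Proof.
rewrite !wnormE; apply: le_trans (sqrt_sum_cauchy_schwarz _ _); rewrite ler_sum// => t _.
by rewrite mulrACA -expr2 sqr_sqrtr.
Qed.

Hypothesis p_sum1 : \sum_t p t = 1.

Lemma wnorm_le_sup l (v : R) : 0 <= v -> (forall t, cabs (l t) <= v) -> wnorm l <= v.
Proof.
move=> v0 lv; rewrite -[leRHS]ger0_norm// -sqrtr_sqr ler_wsqrtr//.
rewrite -[leRHS]mul1r -p_sum1 mulr_suml ler_sum// => t _.
by rewrite ler_wpM2l// ler_pXn2r ?nnegrE ?cabs_ge0.
Qed.

(** The weight sqrt(p) carried by [g] is moved onto [l] before Cauchy-Schwarz. This separates the
    norm of the polynomial data from the local norm of the vector. *)
Lemma sum_le_hnorm_wnorm (f g l : T -> R[i]) :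
  (forall t, cabs (g t) = cabs (f t) * Num.sqrt (p t)) ->
  cabs (\sum_t g t * l t) <= hnorm f * wnorm l.
Proof.
move=> gE; rewrite wnormE /hnorm; apply: le_trans (cabs_sum _) _.
apply: le_trans (sqrt_sum_cauchy_schwarz _ _); rewrite ler_sum// => t _.
by rewrite cabsM gE mulrA.
Qed.

End WeightedNorm.

(** * Perturbation of a single row of the Newton system *)

Definition pert_rate (R : realType) (r : R) : R :=
  expR r + expR r ^+ 2 * (1 + expR r) * r.

Lemma pert_rate_ge0 (R : realType) (r : R) : 0 <= r -> 0 <= pert_rate r.
Proof.
move=> r0; rewrite addr_ge0 ?expR_ge0//.
by rewrite !mulr_ge0 ?addr_ge0 ?expR_ge0.
Qed.

(* [p] is the probability vector of the i-th factor at the zero, [g] the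
   normalized coefficients there, and [h], [l] are the values of
   [a - m_i(z)] on the displacement and on another vector; [drift] is the
   variation of the momentum evaluated on the vector. *)
Section RowPerturbation.
Context {R : realType} {T : finType}.
Variables (p : T -> R) (f g h : T -> R[i]) (r v : R).
Hypothesis p_ge0 : forall t, 0 <= p t.
Hypothesis p_sum1 : \sum_t p t = 1.
Hypothesis gE : forall t, cabs (g t) = cabs (f t) * Num.sqrt (p t).
Hypothesis v_le : 0 <= v <= r.
Hypothesis hv : forall t, cabs (h t) <= v.
Hypothesis h_mean0 : \sum_t (p t)%:C * h t = 0.

Let v0 : 0 <= v. Proof. by case/andP: v_le. Qed.
Let vr : v <= r. Proof. by case/andP: v_le. Qed.
Let hr t : cabs (h t) <= r. Proof. exact: le_trans (hv t) vr. Qed.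
Let b := expR r.
Let b0 : 0 <= b. Proof. exact: expR_ge0. Qed.

(** Up to a factor common to all indices, this is the probability vector at the displaced point;
    leaving it unnormalized avoids the kernels at both points. *)
Definition tilt t : R := p t * expR (2 * complex.Re (h t)).

Definition drift (l : T -> R[i]) : R[i] :=
  (\sum_t (tilt t)%:C * l t) / (\sum_t tilt t)%:C.

(** At a zero the coefficients [g] sum to 0, so the subtracted 1 does not change the sum; it makes
    the first-order smallness in [h] visible. *)
Definition exp_gap : R[i] := \sum_t g t * (cexp (h t) - 1).

(* Jensen's inequality for the centered values [h], via [1 + x <= e^x]. *)
Lemma tilt_sum_ge1 : 1 <= \sum_t tilt t.
Proof.
have E : \sum_t p t * (1 + 2 * complex.Re (h t)) = 1.
  under eq_bigr do rewrite mulrDr mulr1 mulrCA.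
  rewrite big_split /= p_sum1 -mulr_sumr.
  have -> : \sum_t p t * complex.Re (h t) = complex.Re (\sum_t (p t)%:C * h t).
    rewrite raddf_sum; apply: eq_bigr => t _.
    by case: (h t) => x y /=; rewrite mul0r subr0.
  by rewrite h_mean0 /= mulr0 addr0.
by rewrite -[leLHS]E ler_sum// => t _; rewrite ler_wpM2l// expR_ge1Dx.
Qed.

Let tilt_sub t : `|tilt t - p t| <= p t * (b * (1 + b) * cabs (h t)).
Proof.
rewrite /tilt -[X in _ - X]mulr1 -mulrBr normrM ger0_norm//.
rewrite ler_wpM2l//; set s := complex.Re _.
have sh : `|s| <= cabs (h t) by exact: normr_Re_le.
have sr : `|s| <= r by exact: le_trans (hr t).
(* Factoring the difference of squares gives the constant b(1 + b), sharper than the 2 b^2 of a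
   direct estimate. *)
have -> : expR (2 * s) - 1 = (expR s - 1) * (1 + expR s).
  by rewrite mulr_natl mulr2n expRD; ring.
have e1 : `|expR s - 1| <= b * `|s|.
  have := @cabs_cexp_sub1 R s%:C r; rewrite cabsR => /(_ sr).
  by rewrite cexpR -[1]/((1 : R)%:C) -rmorphB cabsR.
rewrite normrM -mulrA [_ * cabs _]mulrC mulrA ler_pM//.
  by rewrite (le_trans e1)// ler_wpM2l.
rewrite ger0_norm ?addr_ge0 ?expR_ge0// lerD2l ler_expR.
exact: le_trans (ler_norm _) sr.
Qed.

(** As [l] is centered for [p], only the first-order difference [tilt - p] contributes, and the
    normalizing denominator is at least 1. *)
Lemma cabs_drift l : \sum_t (p t)%:C * l t = 0 ->
  cabs (drift l) <= b * (1 + b) * wnorm p h * wnorm p l.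
Proof.
move=> l0; have Q1 := tilt_sum_ge1; have Q0 := lt_le_trans ltr01 Q1.
rewrite /drift cabsM cabsV cabsR ger0_norm ?(ltW Q0)//.
rewrite ler_pdivrMr//.
apply: (@le_trans _ _ (b * (1 + b) * wnorm p h * wnorm p l)); last first.
  by rewrite ler_peMr// !mulr_ge0 ?addr_ge0 ?wnorm_ge0.
have -> : \sum_t (tilt t)%:C * l t = \sum_t (tilt t - p t)%:C * l t.
  under [RHS]eq_bigr do rewrite rmorphB mulrBl.
  by rewrite sumrB l0 subr0.
apply: le_trans (cabs_sum _) _.
apply: (@le_trans _ _ (b * (1 + b) * \sum_t p t * (cabs (h t) * cabs (l t)))).
  rewrite mulr_sumr ler_sum// => t _; rewrite cabsM cabsR.
  apply: (@le_trans _ _ (p t * (b * (1 + b) * cabs (h t)) * cabs (l t))).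
    by rewrite ler_wpM2r ?cabs_ge0.
  by rewrite le_eqVlt; apply/orP; left; apply/eqP; ring.
by rewrite -[leRHS]mulrA ler_wpM2l ?wnorm_dot// mulr_ge0 ?addr_ge0.
Qed.

Lemma cabs_exp_gap : cabs exp_gap <= hnorm f * (b * wnorm p h).
Proof.
apply: le_trans (sum_le_hnorm_wnorm p_ge0 _ gE) _.
rewrite ler_wpM2l ?sqrtr_ge0//; apply: ler_wnorm => // t.
exact: cabs_cexp_sub1.
Qed.

Let drift_gap l : \sum_t (p t)%:C * l t = 0 ->
  cabs (drift l * exp_gap) <= hnorm f * (b ^+ 2 * (1 + b) * r * v * wnorm p l).
Proof.
move=> l0; rewrite cabsM.
have H : wnorm p h <= v by exact: wnorm_le_sup.
have H0 : 0 <= wnorm p h := wnorm_ge0 _ _.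
apply: (@le_trans _ _ ((b * (1 + b) * wnorm p h * wnorm p l) * (hnorm f * (b * wnorm p h)))).
  by apply: ler_pM; rewrite ?cabs_ge0 ?cabs_drift ?cabs_exp_gap.
(* The product is quadratic in the norm of [h]: one factor is spent as [r] and the other kept as
   [v], so that the bound is linear in [v] like the main term. *)
rewrite [leLHS](_ : _ = hnorm f * (b ^+ 2 * (1 + b) * (wnorm p h * wnorm p h) * wnorm p l)); last by ring.
rewrite ler_wpM2l ?sqrtr_ge0// ler_wpM2r ?wnorm_ge0// -[leRHS]mulrA ler_wpM2l//.
  by rewrite !mulr_ge0 ?addr_ge0.
by rewrite ler_pM// (le_trans H).
Qed.

(** This is the origin of [pert_rate]: its summand e^r comes from the exponential term [s], and the
    rest from the product of drift and gap [d]. *)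
Let combine (s d : R[i]) (w : R) : 0 <= w ->
  cabs s <= hnorm f * (b * v * w) ->
  cabs d <= hnorm f * (b ^+ 2 * (1 + b) * r * v * w) ->
  cabs (s - d) <= hnorm f * (pert_rate r * v * w).
Proof.
move=> w0 hs hd; apply: le_trans (cabsB _ _) _; apply: le_trans (lerD hs hd) _.
by rewrite le_eqVlt; apply/orP; left; apply/eqP; rewrite /pert_rate -/b; ring.
Qed.

(** When [g] sums to 0, the expression is the difference between the rescaled row at the displaced
    point and the row at the zero, both applied to [l]. The factor e^h - 1 makes its first term
    small. *)
Lemma row_perturbation l : \sum_t (p t)%:C * l t = 0 ->
  cabs (\sum_t g t * ((cexp (h t) - 1) * l t) - drift l * exp_gap)
  <= hnorm f * (pert_rate r * v * wnorm p l).
Proof.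
move=> l0; apply: combine; rewrite ?wnorm_ge0 ?drift_gap//.
apply: le_trans (sum_le_hnorm_wnorm p_ge0 _ gE) _.
rewrite ler_wpM2l ?sqrtr_ge0//; apply: ler_wnorm => [//|| t]; first exact: mulr_ge0.
rewrite cabsM ler_wpM2r ?cabs_ge0// (le_trans (cabs_cexp_sub1 (hr t)))//.
by rewrite ler_wpM2l.
Qed.

(** Applying the displaced row to [h] itself and subtracting the value of the system leaves this
    residual, the added 1 costing nothing when [g] sums to 0. First-order terms cancel, leaving the
    second-order Taylor bound. *)
Lemma row_residual :
  cabs (\sum_t g t * (cexp (h t) * h t - cexp (h t) + 1) - drift h * exp_gap)
  <= hnorm f * (pert_rate r * v * wnorm p h).
Proof.
apply: combine; rewrite ?wnorm_ge0 ?drift_gap//.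
apply: le_trans (sum_le_hnorm_wnorm p_ge0 _ gE) _.
rewrite ler_wpM2l ?sqrtr_ge0//; apply: ler_wnorm => [//|| t]; first exact: mulr_ge0.
apply: le_trans (cabs_cexp_taylor (hr t)) _.
by rewrite expr2 -mulrA ler_wpM2l// ler_wpM2r ?cabs_ge0.
Qed.

End RowPerturbation.

(** * Identification of a differential from a quadratic remainder *)

Section DifferentialAtZero.
Context {K : numFieldType}.

Lemma norm_entry_le (p q : nat) (M : 'M[K]_(p, q)) i j : `|M i j| <= `|M|.
Proof.
rewrite [leRHS]/Num.norm /= mx_normE.
have := @le_bigmax _ _ _ 0%:nng
  (fun k : 'I_p * 'I_q => `|M k.1 k.2|%:nng) (i, j).
exact.
Qed.

Lemma norm_mx_le (p q : nat) (M : 'M[K]_(p, q)) (c : K) :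
  0 <= c -> (forall i j, `|M i j| <= c) -> `|M| <= c.
Proof.
move=> c0 Mc; rewrite [leLHS]/Num.norm /= mx_normE.
rewrite -[c]/((NngNum c0)%:num) num_le; apply: bigmax_le => [|[i j] _].
  by rewrite -num_le.
by rewrite -num_le /=.
Qed.

Lemma norm_mulmx_entry_le (m n : nat) (B : 'M[K]_(m, n)) (u : 'cV[K]_n) i :
  `|(B *m u) i 0| <= (\sum_j `|B i j|) * `|u|.
Proof.
rewrite mxE mulr_suml (le_trans (ler_norm_sum _ _ _))// ler_sum// => j _.
by rewrite normrM ler_wpM2l// norm_entry_le.
Qed.

Lemma mulmx_continuous (m n : nat) (B : 'M[K]_(m, n)) :
  continuous (mulmx B : 'cV[K]_n -> 'cV[K]_m).
Proof.
apply: (bounded_linear_continuous (f := mulmx B)); apply/linear_boundedP.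
pose c := \sum_i \sum_j `|B i j|.
have c0 : 0 <= c by apply: sumr_ge0 => i _; exact: sumr_ge0.
have /nbhs_pinfty_ge : c \is Num.real by rewrite ger0_real.
apply: filterS => r cr u; apply: norm_mx_le => [|i j].
  by apply: mulr_ge0 => //; exact: le_trans cr.
rewrite !ord1 (le_trans (norm_mulmx_entry_le _ _ _))// ler_wpM2r//.
apply: le_trans cr; rewrite /c (bigD1 i)//= lerDl.
by apply: sumr_ge0 => k _; exact: sumr_ge0.
Qed.

Lemma diff0_quadratic (m n : nat) (f : 'cV[K]_n -> 'cV[K]_m) (B : 'M[K]_(m, n))
    (C d : K) : 0 <= C -> 0 < d ->
  (forall u i, `|u| <= d ->
     `|f u i 0 - f 0 i 0 - (B *m u) i 0| <= C * `|u| ^+ 2) ->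
  'd f 0 = mulmx B :> ('cV[K]_n -> 'cV[K]_m).
Proof.
move=> C0 d0 hf.
apply: (diff_unique (df := mulmx B)); first exact: mulmx_continuous.
apply/eqaddoP => e e0.
(* Dividing by C + 1 instead of C covers the case C = 0. *)
have Ce : 0 < e / (C + 1) by rewrite divr_gt0// ltr_wpDl.
have := nbhs0_lt (V := 'cV[K]_n) Ce; have := nbhs0_lt (V := 'cV[K]_n) d0.
apply: filterS2 => u ud ue.
apply: norm_mx_le => [|i j]; first by apply: mulr_ge0 => //; exact: ltW.
rewrite !ord1 !fctE /= addr0 opprD addrA.
have -> : (f u - f 0 - B *m u) i 0 = f u i 0 - f 0 i 0 - (B *m u) i 0.
  by rewrite !mxE.
apply: le_trans (hf u i (ltW ud)) _.
rewrite expr2 mulrA ler_wpM2r//.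
apply: (@le_trans _ _ ((C + 1) * `|u|)).
  by rewrite ler_wpM2r// lerDl.
rewrite mulrC -ler_pdivlMr ?ltr_wpDl//; exact: ltW.
Qed.

End DifferentialAtZero.

(** * Pairing of real covectors with complex vectors *)

Section RowCol.
Context {R : realType} {n : nat}.
Implicit Types (a b : 'rV[R]_n) (u v : 'cV[R[i]]_n).

Lemma rowcolDr a u v : rowcol a (u + v) = rowcol a u + rowcol a v.
Proof. by rewrite -big_split; apply: eq_bigr => j _; rewrite mxE mulrDr. Qed.

Lemma rowcolZr a (c : R[i]) u : rowcol a (c *: u) = c * rowcol a u.
Proof. by rewrite mulr_sumr; apply: eq_bigr => j _; rewrite mxE mulrCA. Qed.

Lemma rowcolBr a u v : rowcol a (u - v) = rowcol a u - rowcol a v.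
Proof. by rewrite rowcolDr -scaleN1r rowcolZr mulN1r. Qed.

Lemma rowcol0r a : rowcol a 0 = 0.
Proof. by rewrite -(scale0r 0) rowcolZr mul0r. Qed.

Lemma rowcolBl a b u : rowcol (a - b) u = rowcol a u - rowcol b u.
Proof.
by rewrite -sumrB; apply: eq_bigr => j _; rewrite !mxE rmorphB mulrBl.
Qed.

Lemma rowcol_suml (T : finType) (c : T -> R) (a : T -> 'rV[R]_n) u :
  rowcol (\sum_t c t *: a t) u = \sum_t (c t)%:C * rowcol (a t) u.
Proof.
under [RHS]eq_bigr do rewrite mulr_sumr.
rewrite exchange_big; apply: eq_bigr => j _ /=.
rewrite summxE rmorph_sum mulr_suml; apply: eq_bigr => t _ /=.
by rewrite mxE rmorphM mulrA.
Qed.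

Lemma norm_rowcol_le a u : `|rowcol a u| <= (\sum_j `|a 0 j|)%:C * `|u|.
Proof.
rewrite rmorph_sum mulr_suml (le_trans (ler_norm_sum _ _ _))// ler_sum// => j _.
by rewrite normrM normc_cabs cabsR ler_wpM2l ?norm_entry_le// ler0c.
Qed.

End RowCol.

Lemma ler_sum1 (R : numDomainType) (T : finType) (F : T -> R) t :
  (forall s, 0 <= F s) -> F t <= \sum_s F s.
Proof. by move=> F0; rewrite (bigD1 t)//= lerDl sumr_ge0. Qed.

(** * The differential of the renormalized system *)

Section NewtonDifferential.
Context {R : realType} {n : nat} {A : 'I_n -> {fset 'rV[R]_n}}.
Variables (rho : forall i, A i -> R) (f : forall i, {ffun A i -> R[i]}).
Implicit Types (x u : 'cV[R[i]]_n).

Local Notation W x i := (renormW rho x i x).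
Lemma renormWE x u i (a : A i) :
  renormW rho x i u a = (rho a)%:C * cexp (rowcol (val a - momentum rho i x) u).
Proof. by rewrite !ffunE mulrCA -cexpD rowcolBl addrC. Qed.

Lemma renormW_shift x u i (a : A i) :
  renormW rho x i (x + u) a = W x i a * cexp (rowcol (val a - momentum rho i x) u).
Proof. by rewrite !renormWE rowcolDr cexpD mulrA. Qed.

(** With the momentum frozen at [x], each summand depends on the displacement only through e^w, w =
    (a - m_i(x)) u. So the remainder is a combination of the quantities e^w - 1 - w, which are
    quadratic. *)
Lemma newtonDS_row x u i : (newtonDS rho f x *m u) i 0 =
  (hnorm (W x i))^-1%:C *
    \sum_a f i a * (W x i a * rowcol (val a - momentum rho i x) u).
Proof.
pose al i (a : A i) := val a - momentum rho i x.
pose c i : R[i] := (hnorm (W x i))^-1%:C.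
pose B := \matrix_(i, j) (c i * \sum_a f i a * (W x i a * (al i a 0 j)%:C)).
have BE i' v : (B *m v) i' 0
    = c i' * \sum_a f i' a * (W x i' a * rowcol (al i' a) v).
  rewrite mxE; under eq_bigr do rewrite mxE -mulrA.
  rewrite -mulr_sumr; congr (_ * _); under eq_bigr do rewrite mulr_suml.
  rewrite exchange_big; apply: eq_bigr => a _ /=.
  by rewrite !mulr_sumr; apply: eq_bigr => j _; rewrite !mulrA.
suff dE : 'd (newtonS rho f x) 0 = mulmx B :> ('cV[R[i]]_n -> 'cV[R[i]]_n).
  suff -> : newtonDS rho f x = B by exact: BE.
  apply/matrixP => k j; rewrite [LHS]mxE dE mxE (bigD1 j)//= big1 => [|l lj].
    by rewrite [delta_mx _ _ _ _]mxE !eqxx mulr1 addr0.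
  by rewrite [delta_mx _ _ _ _]mxE (negbTE lj) mulr0.
(* M dominates every covector, and its leading 1 makes it invertible: on the ball of radius 1/M all
   exponents have modulus at most 1. *)
pose M : R := 1 + \sum_i \sum_a \sum_j `|al i a 0 j|.
have M1 : 1 <= M.
  by rewrite lerDl; do 2 (apply: sumr_ge0 => ? _); apply: sumr_ge0.
have M0 : 0 < M := lt_le_trans ltr01 M1.
pose D : R := \sum_i \sum_a cabs (c i) * cabs (f i a * W x i a).
have D0 : 0 <= D.
  by do 2 (apply: sumr_ge0 => ? _); rewrite mulr_ge0 ?cabs_ge0.
pose e : R := expR 1.
have e0 : 0 <= e := expR_ge0 _.
apply: (@diff0_quadratic _ _ _ _ _ (D * (2 * e * M ^+ 2))%:C M^-1%:C).
- by rewrite ler0c !mulr_ge0// ltW.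
- by rewrite ltcR invr_gt0.
move=> v k vM.
have vR : `|v| = (complex.Re `|v|)%:C by rewrite RRe_real// normr_real.
set N := complex.Re `|v| in vR *.
have N0 : 0 <= N by rewrite -ler0c -vR.
have MNE : (M * N)%:C = M%:C * `|v| by rewrite vR -rmorphM.
have wN a : cabs (rowcol (al k a) v) <= M * N.
  rewrite -lecR MNE -normc_cabs (le_trans (norm_rowcol_le _ _))//.
  rewrite ler_wpM2r// lecR /M -[leLHS]add0r lerD//.
  apply: le_trans (ler_sum1 k _) => [|i']; last first.
    by do 2 (apply: sumr_ge0 => ? _).
  by apply: (ler_sum1 a) => a'; apply: sumr_ge0.
have w1 a : cabs (rowcol (al k a) v) <= 1.
  apply: le_trans (wN a) _; rewrite -ler_pdivlMl// mulr1.
  by rewrite -lecR -vR.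
have NM0 : 0 <= M * N by rewrite mulr_ge0// ltW.
have taylor a : cabs (cexp (rowcol (al k a) v) - 1 - rowcol (al k a) v)
    <= 2 * e * (M * N) ^+ 2.
  set w := rowcol _ _.
  (* This splitting reduces the Taylor remainder to the two exponential estimates already
     available. *)
  have -> : cexp w - 1 - w = w * (cexp w - 1) - (cexp w * w - cexp w + 1) by ring.
  apply: le_trans (cabsB _ _) _; rewrite cabsM.
  apply: (@le_trans _ _ (cabs w * (e * cabs w) + e * cabs w ^+ 2)).
    rewrite lerD ?cabs_cexp_taylor ?w1// ler_wpM2l ?cabs_ge0//.
    by rewrite cabs_cexp_sub1 ?w1.
  rewrite [leLHS](_ : _ = 2 * e * cabs w ^+ 2); last by ring.
  rewrite ler_wpM2l ?mulr_ge0// ler_pXn2r ?nnegrE ?cabs_ge0//; exact: wN.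
have -> : newtonS rho f x v k 0 - newtonS rho f x 0 k 0 - (B *m v) k 0 =
    c k * \sum_a (f k a * W x k a) * (cexp (rowcol (al k a) v) - 1 - rowcol (al k a) v).
  rewrite BE !mxE addr0 -!mulrBr -!sumrB; congr (_ * _).
  apply: eq_bigr => a _; rewrite renormW_shift; ring.
rewrite vR normc_cabs -rmorphXn -rmorphM lecR.
rewrite cabsM; apply: (@le_trans _ _ (cabs (c k) * \sum_a cabs (f k a * W x k a) * (2 * e * (M * N) ^+ 2))).
  rewrite ler_wpM2l ?cabs_ge0// (le_trans (cabs_sum _))// ler_sum// => a _.
  by rewrite cabsM ler_wpM2l ?cabs_ge0.
rewrite -mulr_suml [leLHS]mulrA exprMn [leRHS](_ : _ = D * (2 * e * (M ^+ 2 * N ^+ 2))); last by ring.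
rewrite ler_wpM2r ?mulr_ge0 ?sqr_ge0 ?(ltW M0)// mulr_sumr.
by apply: (ler_sum1 k) => l /=; apply: sumr_ge0 => a _; rewrite mulr_ge0 ?cabs_ge0.
Qed.

End NewtonDifferential.

(** * Probabilities, local seminorms and the distortion [nu] *)

Section LocalGeometry.
Context {R : realType} {n : nat} {A : 'I_n -> {fset 'rV[R]_n}}.
Variable rho : forall i, A i -> R.
Hypothesis A_neq0 : forall i, A i != fset0.
Hypothesis rho_gt0 : forall i (a : A i), 0 < rho a.
Implicit Types (i : 'I_n) (x z u h : 'cV[R[i]]_n).

Lemma kernelK_gt0 i x : 0 < kernelK rho i x.
Proof.
have [a0 a0A] := fset0Pn (A i) (A_neq0 i).
have pos (a : A i) : 0 < rho a ^+ 2 * expR (2 * complex.Re (rowcol (val a) x)).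
  by rewrite mulr_gt0 ?expR_gt0// exprn_gt0.
apply: lt_le_trans (pos (FSetSub a0A)) _.
by apply: (ler_sum1 (FSetSub a0A)) => a; exact: ltW.
Qed.

Lemma prob_gt0 i x (a : A i) : 0 < prob rho x a.
Proof.
by rewrite divr_gt0 ?kernelK_gt0// mulr_gt0 ?expR_gt0// exprn_gt0.
Qed.

Lemma prob_ge0 i x (a : A i) : 0 <= prob rho x a.
Proof. exact/ltW/prob_gt0. Qed.

Lemma prob_sum1 i x : \sum_(a : A i) prob rho x a = 1.
Proof. by rewrite -mulr_suml divff// gt_eqF// kernelK_gt0. Qed.

Lemma prob_mean0 i x u :
  \sum_(a : A i) (prob rho x a)%:C * rowcol (val a - momentum rho i x) u = 0.
Proof.
under eq_bigr do rewrite rowcolBl mulrBr.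
rewrite sumrB -rowcol_suml -mulr_suml -rmorph_sum /= prob_sum1.
by rewrite mul1r subrr.
Qed.

(** The factor e^(-m_i(x) x) is common to all exponents, so normalizing the evaluation vector leaves
    moduli that are square roots of the probabilities. *)
Lemma cabs_renormW i x (a : A i) : cabs (renormW rho x i x a)
  = Num.sqrt (prob rho x a) * hnorm (renormW rho x i x).
Proof.
have sqrW (b : A i) : cabs (renormW rho x i x b) ^+ 2 =
    prob rho x b * (kernelK rho i x * expR (- complex.Re (rowcol (momentum rho i x) x)) ^+ 2).
  rewrite renormWE cabsM cabsR cabs_cexp exprMn real_normK ?num_real//.
  rewrite mulrA /prob divfK ?gt_eqF ?kernelK_gt0// -mulrA; congr (_ * _).
  by rewrite -!expRM_natl -expRD rowcolBl raddfB /= -mulrDr.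
rewrite /hnorm; under eq_bigr do rewrite sqrW.
rewrite -mulr_suml prob_sum1 mul1r -sqrtrM ?prob_ge0// -sqrW sqrtr_sqr.
by rewrite ger0_norm ?cabs_ge0.
Qed.

Lemma hnorm_renormW_neq0 i x : hnorm (renormW rho x i x) != 0.
Proof.
have [a0 a0A] := fset0Pn (A i) (A_neq0 i).
apply/eqP => W0; have := cabs_renormW x (FSetSub a0A).
move/eqP; rewrite W0 mulr0 cabs_eq0 renormWE mulf_eq0 (negbTE (cexp_neq0 _)) orbF.
by rewrite -(rmorph0 (real_complex R)) (inj_eq (@complexI R)) gt_eqF.
Qed.

Lemma lnorm_iE i x u :
  lnorm_i rho i x u =
  wnorm (prob rho x) (fun a : A i => rowcol (val a - momentum rho i x) u).
Proof. by []. Qed.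

Lemma lnorm_i_ge0 i x u : 0 <= lnorm_i rho i x u.
Proof. exact: sqrtr_ge0. Qed.

Lemma lnorm_ge0 x u : 0 <= lnorm rho x u.
Proof. exact: sqrtr_ge0. Qed.

Lemma lnorm_i_le i x u : lnorm_i rho i x u <= lnorm rho x u.
Proof.
rewrite -[leLHS]ger0_norm ?lnorm_i_ge0// -sqrtr_sqr ler_wsqrtr//.
by apply: (ler_sum1 i) => j; exact: sqr_ge0.
Qed.

Lemma lnorm_iZ i x (c : R) u : 0 <= c ->
  lnorm_i rho i x (c%:C *: u) = c * lnorm_i rho i x u.
Proof.
move=> c0; rewrite !lnorm_iE !(wnormE (@prob_ge0 _ _))// -sqrt_sumZ//.
congr Num.sqrt; apply: eq_bigr => a _.
by rewrite rowcolZr cabsM cabsR ger0_norm// mulrCA.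
Qed.

Lemma lnormZ x (c : R) u : 0 <= c -> lnorm rho x (c%:C *: u) = c * lnorm rho x u.
Proof.
move=> c0; rewrite /lnorm -sqrt_sumZ//.
by congr Num.sqrt; apply: eq_bigr => i _; rewrite lnorm_iZ.
Qed.

Lemma nu_ge0 x : 0 <= nu rho x.
Proof. exact: bigmax_ge_id. Qed.

Lemma cabs_rowcol_le_nu i x (a : A i) u :
  cabs (rowcol (val a - momentum rho i x) u) <= nu rho x * lnorm_i rho i x u.
Proof.
set al := val a - _.
have pa := prob_gt0 x a.
have le_sqrt v : Num.sqrt (prob rho x a) * cabs (rowcol al v) <= lnorm_i rho i x v.
  by apply: (cabs_le_wnorm _ (fun b => rowcol (val b - _) v) a) => b; exact: prob_ge0.
have s0 : 0 < Num.sqrt (prob rho x a) by rewrite sqrtr_gt0.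
pose S := [set r | exists2 v, lnorm_i rho i x v <= 1 & r = cabs (rowcol al v)]%classic.
have supS : sup S <= nu rho x.
  apply: le_trans (le_bigmax _ _ i).
  exact: (@le_bigmax _ _ _ _ (fun b : A i => sup [set r | exists2 v,
    lnorm_i rho i x v <= 1 & r = cabs (rowcol (val b - momentum rho i x) v)]%classic) a).
(* A [sup] controls its set only if the set is bounded above; 1 / sqrt(p_a) is a bound, by
   positivity of p_a. *)
have inS v : lnorm_i rho i x v <= 1 -> cabs (rowcol al v) <= nu rho x.
  move=> v1; apply: le_trans supS; apply: ub_le_sup; last by exists v.
  exists (Num.sqrt (prob rho x a))^-1 => _ [w w1 ->].
  by rewrite -[leRHS]mulr1 ler_pdivlMl// (le_trans (le_sqrt w)).
(* A vector of seminorm 0 cannot be normalized, but each of its weighted components then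
   vanishes. *)
have [l0|l0] := eqVneq (lnorm_i rho i x u) 0.
  by rewrite l0 mulr0 -(pmulr_rle0 _ s0) -l0.
have lp : 0 < lnorm_i rho i x u by rewrite lt_neqAle eq_sym l0 lnorm_i_ge0.
have := inS ((lnorm_i rho i x u)^-1%:C *: u).
rewrite lnorm_iZ ?invr_ge0 ?lnorm_i_ge0// mulVf// => /(_ (lexx _)).
by rewrite rowcolZr cabsM cabsR ger0_norm ?invr_ge0 ?lnorm_i_ge0// ler_pdivrMl// mulrC.
Qed.

End LocalGeometry.

(** * The condition number as an operator norm *)

Section ConditionNumber.
Context {R : realType} {n : nat} {A : 'I_n -> {fset 'rV[R]_n}}.
Variables (rho : forall i, A i -> R) (f : forall i, {ffun A i -> R[i]}).
Hypothesis A_neq0 : forall i, A i != fset0.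
Hypothesis rho_gt0 : forall i (a : A i), 0 < rho a.
Implicit Types (i : 'I_n) (x z u h w : 'cV[R[i]]_n).

Local Notation cvnorm w := (hnorm (fun i => w i 0)).

Lemma cabs_le_hnorm (T : finType) (v : T -> R[i]) t : cabs (v t) <= hnorm v.
Proof.
rewrite -[leLHS]ger0_norm ?cabs_ge0// -sqrtr_sqr ler_wsqrtr//.
by apply: (ler_sum1 t) => s; exact: sqr_ge0.
Qed.

Lemma hnormZ (T : finType) (v : T -> R[i]) (c : R) : 0 <= c ->
  hnorm (fun t => c%:C * v t) = c * hnorm v.
Proof.
move=> c0; rewrite /hnorm -sqrt_sumZ//; congr Num.sqrt; apply: eq_bigr => t _.
by rewrite cabsM cabsR ger0_norm.
Qed.

Lemma hnorm_eq0 (T : finType) (v : T -> R[i]) : hnorm v = 0 -> forall t, v t = 0.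
Proof.
move=> v0 t; apply/eqP; rewrite -cabs_eq0 eq_le cabs_ge0 andbT -v0.
exact: cabs_le_hnorm.
Qed.

(** This makes the set defining [mu] bounded above, so that its [sup] really dominates its
    elements. *)
Lemma lnorm_mulmx_bounded x (M : 'M[R[i]]_n) :
  exists C : R, forall w, cvnorm w <= 1 -> lnorm rho x (M *m w) <= C.
Proof.
pose S i (a : A i) := \sum_j cabs (rowcol (val a - momentum rho i x) (col j M)).
exists (Num.sqrt (\sum_i (Num.sqrt (\sum_(a : A i) prob rho x a * S i a ^+ 2)) ^+ 2)).
move=> w w1; apply: ler_sqrt_sum => i; rewrite sqrtr_ge0/= ler_wsqrtr//.
rewrite ler_sum// => a _; rewrite ler_wpM2l ?prob_ge0//.
rewrite ler_pXn2r ?nnegrE ?cabs_ge0//; last by apply: sumr_ge0 => j _; exact: cabs_ge0.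
have -> : M *m w = \sum_j w j 0 *: col j M.
  apply/colP => k; rewrite summxE mxE; apply: eq_bigr => j _.
  by rewrite !mxE mulrC.
have -> : rowcol (val a - momentum rho i x) (\sum_j w j 0 *: col j M)
    = \sum_j w j 0 * rowcol (val a - momentum rho i x) (col j M).
  elim/big_ind2 : _ => [|u u' v v' hu hv|j _]; first exact: rowcol0r.
    by rewrite rowcolDr hu hv.
  by rewrite rowcolZr.
rewrite (le_trans (cabs_sum _))// ler_sum// => j _.
rewrite cabsM ler_piMl ?cabs_ge0// (le_trans _ w1)//.
exact: (cabs_le_hnorm (fun j => w j 0)).
Qed.

Lemma lnorm_le_mu z e w : newtonDS rho f z \in unitmx ->
  newtonDS rho f z *m e = diag_mx (\row_i (hnorm (f i))%:C) *m w ->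
  lnorm rho z e <= mu rho f z * cvnorm w.
Proof.
move=> DSu DSe.
have eE : e = invmx (newtonDS rho f z) *m (diag_mx (\row_i (hnorm (f i))%:C) *m w).
  by rewrite -DSe mulKmx.
have [C hC] := lnorm_mulmx_bounded z
  (invmx (newtonDS rho f z) *m diag_mx (\row_i (hnorm (f i))%:C)).
have in_mu (v : 'cV[R[i]]_n) : cvnorm v <= 1 -> lnorm rho z
    (invmx (newtonDS rho f z) *m (diag_mx (\row_i (hnorm (f i))%:C) *m v)) <= mu rho f z.
  move=> v1; apply: ub_le_sup; last by exists v.
  by exists C => _ [v' v'1 ->]; rewrite mulmxA; exact: hC.
have scale_mx (c : R) : 0 <= c -> cvnorm (c%:C *: w) = c * cvnorm w.
  move=> c0; rewrite -hnormZ//; congr Num.sqrt; apply: eq_bigr => i _.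
  by rewrite mxE.
have [w0|w0] := eqVneq (cvnorm w) 0.
  have -> : e = 0.
    rewrite eE (_ : w = 0) ?mulmx0//; apply/colP => i; rewrite mxE.
    exact: (hnorm_eq0 w0).
  by rewrite w0 mulr0 -(scale0r 0) -(rmorph0 (real_complex R)) lnormZ// mul0r.
have wp : 0 < cvnorm w by rewrite lt_neqAle eq_sym w0 sqrtr_ge0.
have := in_mu ((cvnorm w)^-1%:C *: w).
rewrite scale_mx ?invr_ge0 ?sqrtr_ge0// mulVf// => /(_ (lexx _)).
by rewrite -!scalemxAr -eE lnormZ ?invr_ge0 ?sqrtr_ge0// ler_pdivrMl// mulrC.
Qed.

End ConditionNumber.

(** * One Newton step near a non-degenerate zero *)

Lemma unitmx_col_ker0 (F : fieldType) (n : nat) (M : 'M[F]_n) :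
  (forall u : 'cV[F]_n, M *m u = 0 -> u = 0) -> M \in unitmx.
Proof.
move=> M0; rewrite -unitmx_tr -row_free_unit -kermx_eq0; apply/eqP/row_matrixP => k.
rewrite row0; apply: trmx_inj; rewrite trmx0; apply: M0.
by apply: trmx_inj; rewrite trmx_mul trmxK -row_mul mulmx_ker row0 trmx0.
Qed.

(** The first term does not involve [a]: after exponentiation, the change of momentum is a scalar
    common to the whole row. *)
Lemma rowcol_recenter (R : realType) (n : nat) (a m m' : 'rV[R]_n)
    (z h : 'cV[R[i]]_n) :
  rowcol (a - m') (z + h) =
    rowcol (m - m') (z + h) + rowcol (a - m) z + rowcol (a - m) h.
Proof. by rewrite -addrA -rowcolDr !rowcolBl; ring. Qed.

Lemma ler_self_pMl_le0 (R : realFieldType) (c t : R) :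
  c < 1 -> t <= c * t -> t <= 0.
Proof. by move=> c1 tct; nra. Qed.

Section NewtonNearZero.
Context {R : realType} {n : nat} {A : 'I_n -> {fset 'rV[R]_n}}.
Variables (rho : forall i, A i -> R) (f : forall i, {ffun A i -> R[i]}).
Hypothesis A_neq0 : forall i, A i != fset0.
Hypothesis rho_gt0 : forall i (a : A i), 0 < rho a.
Hypothesis n_gt0 : (0 < n)%N.
Hypothesis f_neq0 : forall i, f i != 0.
Variable z : 'cV[R[i]]_n.
Hypothesis z_zero : nondegenerate_zero rho f z.
Implicit Types (i : 'I_n) (h u e : 'cV[R[i]]_n).

Local Notation L i u := (fun a : A i => rowcol (val a - momentum rho i z) u).
Local Notation p i := (fun a : A i => prob rho z a).
Local Notation Wz i := (renormW rho z i z).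

Definition normalized_coef i (a : A i) : R[i] :=
  f i a * (Wz i a / (hnorm (Wz i))%:C).

Local Notation g i := (@normalized_coef i).

Let hnormW_neq0 i x : (hnorm (renormW rho x i x))%:C != 0.
Proof. by rewrite fmorph_eq0 hnorm_renormW_neq0. Qed.

Lemma hnorm_coef_gt0 i : 0 < hnorm (f i).
Proof.
rewrite lt_neqAle sqrtr_ge0 andbT eq_sym; apply: contra (f_neq0 i) => /eqP f0.
by apply/eqP/ffunP => a; rewrite ffunE; exact: (hnorm_eq0 f0).
Qed.

Lemma cabs_normalized_coef i (a : A i) :
  cabs (g i a) = cabs (f i a) * Num.sqrt (prob rho z a).
Proof.
rewrite /normalized_coef !cabsM cabsV cabsR ger0_norm ?sqrtr_ge0//.
by rewrite cabs_renormW// mulfK ?hnorm_renormW_neq0.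
Qed.

Lemma normalized_coef_sum0 i : \sum_a g i a = 0.
Proof.
have [/(_ i) z0 _] := z_zero.
transitivity ((cexp (- rowcol (momentum rho i z) z) / (hnorm (Wz i))%:C)
               * dual_app (evalV rho i z) (f i)); last by rewrite z0 mulr0.
rewrite mulr_sumr; apply: eq_bigr => a _.
by rewrite /normalized_coef !ffunE; ring.
Qed.

Lemma newtonDS_zero_row u i :
  (newtonDS rho f z *m u) i 0 = \sum_a g i a * L i u a.
Proof.
rewrite newtonDS_row mulr_sumr fmorphV; apply: eq_bigr => a _.
by rewrite /normalized_coef; ring.
Qed.

Lemma momentum_drift h u i :
  rowcol (momentum rho i (z + h) - momentum rho i z) u = drift (p i) (L i h) (L i u).
Proof.
(* This is the ratio of the tilted weights to the probabilities at z + h; being independent of [a],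
   it cancels in the quotient defining [drift]. *)
pose k := kernelK rho i (z + h) / kernelK rho i z
  * expR (- (2 * complex.Re (rowcol (momentum rho i z) h))).
have k0 : k != 0.
  by rewrite mulf_neq0 ?mulf_neq0 ?invr_eq0 ?gt_eqF ?expR_gt0 ?kernelK_gt0.
have tE (a : A i) : tilt (p i) (L i h) a = prob rho (z + h) a * k.
  rewrite /tilt /prob /k rowcolDr rowcolBl raddfB raddfD /= !mulrDr mulrN !expRD.
  by field; rewrite !gt_eqF ?kernelK_gt0.
have -> : drift (p i) (L i h) (L i u) =
    \sum_(a : A i) (prob rho (z + h) a)%:C * rowcol (val a - momentum rho i z) u.
  rewrite /drift; under [in X in _ / X]eq_bigr do rewrite tE.
  rewrite -mulr_suml prob_sum1// mul1r mulr_suml; apply: eq_bigr => a _.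
  by rewrite tE rmorphM mulrAC mulfK// fmorph_eq0.
under eq_bigr do rewrite rowcolBl mulrBr.
by rewrite sumrB -rowcol_suml -mulr_suml -rmorph_sum /= prob_sum1// mul1r rowcolBl.
Qed.

(** The scalar collects the ratio of the two normalizations and the recentering of the exponents.
    The same [s] serves the value and the differential, so it drops out of the linear system for the
    Newton step. *)
Lemma newton_row_shift h i : exists2 s : R[i], s != 0 &
  (newtonS rho f (z + h) 0 i 0 = s * \sum_a g i a * cexp (L i h a)) /\
  forall u, (newtonDS rho f (z + h) *m u) i 0 =
    s * \sum_a g i a * (cexp (L i h a) * (L i u a - drift (p i) (L i h) (L i u))).
Proof.
set x := z + h.
pose th := cexp (rowcol (momentum rho i z - momentum rho i x) x).
have WE (a : A i) : renormW rho x i x a = th * Wz i a * cexp (L i h a).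
  rewrite !renormWE.
  have -> : cexp (rowcol (val a - momentum rho i x) x) =
      th * cexp (rowcol (val a - momentum rho i z) z) * cexp (L i h a).
    by rewrite /th -!cexpD -rowcol_recenter.
  by ring.
have th0 : th != 0 := cexp_neq0 _; move: th th0 WE => th th0 WE.
exists ((hnorm (renormW rho x i x))^-1%:C * th * (hnorm (Wz i))%:C).
  apply: mulf_neq0 (mulf_neq0 _ th0) (hnormW_neq0 _ _).
  by rewrite fmorphV invr_eq0 hnormW_neq0.
split=> [|u].
  rewrite mxE addr0 -!mulrA /dual_app; congr (_ * _); rewrite [RHS]mulrA mulr_sumr.
  apply: eq_bigr => a _; rewrite WE /normalized_coef.
  by field; exact: hnormW_neq0.
rewrite newtonDS_row -!mulrA; congr (_ * _); rewrite [RHS]mulrA mulr_sumr.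
apply: eq_bigr => a _; rewrite WE /normalized_coef -momentum_drift -/x !rowcolBl.
by field; exact: hnormW_neq0.
Qed.

Lemma cabs_newtonDS_zero_row u i :
  cabs ((newtonDS rho f z *m u) i 0) <= hnorm (f i) * lnorm_i rho i z u.
Proof.
rewrite newtonDS_zero_row lnorm_iE.
apply: (sum_le_hnorm_wnorm (fun a => prob_ge0 A_neq0 rho_gt0 z a)).
exact: cabs_normalized_coef.
Qed.

(** Each row of the differential is bounded by the local seminorm, so its invertibility forces the
    seminorm to be a norm. *)
Lemma lnorm_eq0 u : lnorm rho z u = 0 -> u = 0.
Proof.
move=> u0; have [_ DSu] := z_zero.
suff DSu0 : newtonDS rho f z *m u = 0 by rewrite -[u](mulKmx DSu u) DSu0 mulmx0.
apply/colP => i; rewrite [RHS]mxE; apply/eqP; rewrite -cabs_eq0 eq_le cabs_ge0 andbT.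
rewrite (le_trans (cabs_newtonDS_zero_row _ _))// mulr_ge0_le0 ?sqrtr_ge0//.
by rewrite -u0 lnorm_i_le.
Qed.

(** Solving the system for a basis vector and comparing one row gives ||f_i|| <= ||f_i|| ||e||_z.
    The bound lets the hypothesis on mu nu ||h||_z also control nu ||h||_z. *)
Lemma mu_ge1 : 1 <= mu rho f z.
Proof.
have [_ DSu] := z_zero; pose i0 := Ordinal n_gt0.
pose w : 'cV[R[i]]_n := delta_mx i0 0.
pose e := invmx (newtonDS rho f z) *m (diag_mx (\row_i (hnorm (f i))%:C) *m w).
have DSe : newtonDS rho f z *m e = diag_mx (\row_i (hnorm (f i))%:C) *m w.
  by rewrite mulKVmx.
have := lnorm_le_mu A_neq0 rho_gt0 DSu DSe.
have -> : hnorm (fun i => w i 0) = 1.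
  rewrite /hnorm (bigD1 i0)//= big1 => [|i ii0]; rewrite mxE.
    by rewrite !eqxx cabs1 expr1n addr0 sqrtr1.
  by rewrite (negbTE ii0) cabs0 expr0n.
rewrite mulr1; apply: le_trans; apply: le_trans (lnorm_i_le rho i0 z e).
rewrite -(ler_pM2l (hnorm_coef_gt0 i0)) mulr1.
apply: le_trans (cabs_newtonDS_zero_row _ _).
rewrite DSe mul_diag_mx !mxE !eqxx mulr1 cabsR ger0_norm// ltW//.
exact: hnorm_coef_gt0.
Qed.

Section Displacement.
Variables (h : 'cV[R[i]]_n) (r : R).
Local Notation v := (nu rho z * lnorm rho z h).
Hypothesis v_le : v <= r.

Let v0 : 0 <= v.
Proof. by rewrite mulr_ge0 ?nu_ge0 ?lnorm_ge0. Qed.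

Let vr : 0 <= v <= r. Proof. by rewrite v0 v_le. Qed.

Let hv i (a : A i) : cabs (L i h a) <= v.
Proof.
rewrite (le_trans (cabs_rowcol_le_nu A_neq0 rho_gt0 _ _ _))//.
by rewrite ler_wpM2l ?nu_ge0// lnorm_i_le.
Qed.

(* [res] and [tau] vanish when the kernel is studied; for the Newton step
   they are the residual and the seminorms of [h]. *)
Lemma shifted_system_bound e (res : 'I_n -> R[i]) (tau : 'I_n -> R) :
  (forall i, \sum_a g i a * (cexp (L i h a) * (L i e a - drift (p i) (L i h) (L i e)))
     = res i) ->
  (forall i, 0 <= tau i) ->
  (forall i, cabs (res i) <= hnorm (f i) * (pert_rate r * v * tau i)) ->
  lnorm rho z e <= mu rho f z * (pert_rate r * v *
     (Num.sqrt (\sum_i tau i ^+ 2) + lnorm rho z e)).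
Proof.
move=> Ee tau0 hres.
have [_ DSu] := z_zero.
have r0 : 0 <= r := le_trans v0 v_le.
have k0 : 0 <= pert_rate r * v.
  by rewrite mulr_ge0// pert_rate_ge0.
pose P i := \sum_a g i a * ((cexp (L i h a) - 1) * L i e a)
  - drift (p i) (L i h) (L i e) * exp_gap (g i) (L i h).
have PE i : \sum_a g i a * L i e a = res i - P i.
  rewrite -Ee /P /exp_gap.
  have -> : \sum_a g i a * (cexp (L i h a) - 1) = \sum_a g i a * cexp (L i h a).
    under eq_bigr do rewrite mulrBr mulr1.
    by rewrite sumrB normalized_coef_sum0 subr0.
  rewrite opprB addrA mulr_sumr -big_split -sumrB /=.
  by apply: eq_bigr => a _; ring.
have Pbound i : cabs (P i) <= hnorm (f i) * (pert_rate r * v * lnorm_i rho i z e).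
  rewrite lnorm_iE; apply: row_perturbation => //.
  - by move=> a; exact: prob_ge0.
  - exact: prob_sum1.
  - exact: cabs_normalized_coef.
  - exact: prob_mean0.
  - exact: prob_mean0.
(* Dividing row i by ||f_i|| puts the system at z in the form measured by [mu]. *)
pose w : 'cV[R[i]]_n := \col_i ((res i - P i) / (hnorm (f i))%:C).
have DSe : newtonDS rho f z *m e = diag_mx (\row_i (hnorm (f i))%:C) *m w.
  apply/colP => i; rewrite newtonDS_zero_row PE mul_diag_mx !mxE mulrC divfK//.
  by rewrite fmorph_eq0 gt_eqF ?hnorm_coef_gt0.
apply: le_trans (lnorm_le_mu A_neq0 rho_gt0 DSu DSe) _.
rewrite ler_wpM2l ?(le_trans ler01 mu_ge1)//.
have wi i : cabs (w i 0) <= pert_rate r * v * (tau i + lnorm_i rho i z e).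
  rewrite mxE cabsM cabsV cabsR ger0_norm ?sqrtr_ge0//.
  rewrite ler_pdivrMr ?hnorm_coef_gt0// mulrC mulrDr mulrDr.
  by rewrite (le_trans (cabsB _ _))// lerD.
apply: (@le_trans _ _ (Num.sqrt (\sum_i (pert_rate r * v * (tau i + lnorm_i rho i z e)) ^+ 2))).
  by apply: ler_sqrt_sum => i; rewrite cabs_ge0 wi.
by rewrite sqrt_sumZ// ler_wpM2l// sqrt_sumD.
Qed.

(** A kernel vector solves the shifted system with zero right-hand side, hence its norm is at most a
    fraction less than 1 of itself. *)
Lemma newtonDS_near_unit : mu rho f z * (pert_rate r * v) < 1 ->
  newtonDS rho f (z + h) \in unitmx.
Proof.
move=> small; apply: unitmx_col_ker0 => e DSe; apply: lnorm_eq0.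
have := @shifted_system_bound e (fun=> 0) (fun=> 0).
have -> : Num.sqrt (\sum_(i < n) (0 : R) ^+ 2) = 0.
  by rewrite big1 ?sqrtr0// => i _; rewrite expr0n.
rewrite add0r [mu rho f z * _]mulrA => le_self; apply/eqP; rewrite eq_le lnorm_ge0 andbT.
have : lnorm rho z e <= mu rho f z * (pert_rate r * v) * lnorm rho z e.
  apply: le_self => // i; last by rewrite cabs0 !mulr0.
  have [s s0 [_ /(_ e)]] := newton_row_shift h i.
  by rewrite DSe mxE => /esym/eqP; rewrite mulf_eq0 (negbTE s0) => /eqP.
exact: ler_self_pMl_le0.
Qed.

Lemma newton_near_bound : mu rho f z * (pert_rate r * v) < 1 ->
  lnorm rho z (newton rho f (z + h) - z) <= mu rho f z * (pert_rate r * v *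
     (lnorm rho z h + lnorm rho z (newton rho f (z + h) - z))).
Proof.
move=> small; have DSu := newtonDS_near_unit small.
set e := newton rho f (z + h) - z.
have eE : e = h - invmx (newtonDS rho f (z + h)) *m newtonS rho f (z + h) 0.
  by rewrite /e /newton addrAC [z + h]addrC addrK.
have DSe : newtonDS rho f (z + h) *m e = newtonDS rho f (z + h) *m h - newtonS rho f (z + h) 0.
  by rewrite eE mulmxBr mulKVmx.
apply: (shifted_system_bound (res := fun i =>
    \sum_a g i a * (cexp (L i h a) * L i h a - cexp (L i h a) + 1)
    - drift (p i) (L i h) (L i h) * exp_gap (g i) (L i h))).
- move=> i; have [s s0 [S0 DS]] := newton_row_shift h i.
  apply: (mulfI s0); rewrite -DS DSe.
  have subE (X Y : 'cV[R[i]]_n) : (X - Y) i 0 = X i 0 - Y i 0 by rewrite !mxE.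
  rewrite subE DS S0 -mulrBr; congr (_ * _).
  rewrite /exp_gap mulr_sumr -!sumrB.
  have G0 c : \sum_a g i a * c = 0 by rewrite -mulr_suml normalized_coef_sum0 mul0r.
  apply/eqP; rewrite -subr_eq0 -sumrB; apply/eqP.
  (* The two sides differ by this constant times the sum of the coefficients, which is 0 at a
     zero. *)
  rewrite -[RHS](G0 (- (1 + drift (p i) (L i h) (L i h)))).
  by apply: eq_bigr => a _; ring.
- by move=> i; exact: lnorm_i_ge0.
move=> i; rewrite lnorm_iE; apply: row_residual => //.
- by move=> a; exact: prob_ge0.
- exact: prob_sum1.
- exact: cabs_normalized_coef.
- exact: prob_mean0.
Qed.

End Displacement.

Lemma pert_rate_le : pert_rate (182 / 1000 : R) <= 183 / 100.
Proof.
(* From e^(-r) >= 1 - r one gets e^r <= 1 / 0.818 < 1.223, which suffices in the polynomial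
   expression. *)
have : (1 - 182 / 1000) * expR (182 / 1000 : R) <= 1.
  by rewrite -ler_pdivlMr ?expR_gt0// div1r -expRN expR_ge1Dx.
rewrite /pert_rate; move: (expR _) (expR_ge0 (182 / 1000 : R)) => b b0 hb.
have b_le : b <= 1223 / 1000 by lra.
have b2 : b * b <= 1223 / 1000 * b by exact: ler_wpM2r.
have b3 : b * b * b <= 1223 / 1000 * b * b by exact: ler_wpM2r.
rewrite expr2; lra.
Qed.

(** Write B for mu nu ||h||_z, H for ||h||_z and E for the new error. Then E <= 1.83 B (H + E), and
    B <= 0.182 allows the E on the right to be absorbed: 1.83 / (1 - 1.83 * 0.182) < 2.745. *)
Lemma newton_contraction h :
  mu rho f z * nu rho z * lnorm rho z h <= 182 / 1000 ->
  newtonDS rho f (z + h) \in unitmx /\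
  lnorm rho z (newton rho f (z + h) - z) <=
    2745 / 1000 * (mu rho f z * nu rho z * lnorm rho z h) * lnorm rho z h.
Proof.
have m1 := mu_ge1; have nu0 := nu_ge0 rho z; have H0 := lnorm_ge0 rho z h.
have v0 : 0 <= nu rho z * lnorm rho z h by exact: mulr_ge0.
rewrite -mulrA => beta_le.
have v_le : nu rho z * lnorm rho z h <= 182 / 1000.
  by apply: le_trans beta_le; rewrite ler_peMl.
have kr := pert_rate_le.
have small : mu rho f z * (pert_rate (182 / 1000) * (nu rho z * lnorm rho z h)) < 1.
  rewrite mulrCA; move: (mu _ _ _ * _) beta_le (mulr_ge0 (le_trans ler01 m1) v0) => B BB B0.
  by nra.
split; first exact: newtonDS_near_unit v_le small.
have := newton_near_bound v_le small.
have := lnorm_ge0 rho z (newton rho f (z + h) - z).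
move: beta_le (mulr_ge0 (le_trans ler01 m1) v0).
rewrite [mu rho f z * (_ * (_ + _))]mulrA [mu rho f z * (pert_rate _ * _)]mulrCA.
move: (mu _ _ _ * _) (lnorm _ _ (_ - _)) => B E B_le B0 E0.
have k0 : 0 <= pert_rate (182 / 1000 : R).
  by apply: pert_rate_ge0; lra.
move: (pert_rate _) kr k0 => k kr k0 Ele.
have {}Ele : E <= 183 / 100 * B * (lnorm rho z h + E).
  by apply: le_trans Ele _; rewrite ler_wpM2r ?addr_ge0// ler_wpM2r.
have : B * E <= 182 / 1000 * E by rewrite ler_wpM2r.
have : 0 <= B * lnorm rho z h by rewrite mulr_ge0.
nra.
Qed.

End NewtonNearZero.

(** * Independence of the choice of representatives *)

Lemma rescaled_system (F : fieldType) (n : nat) (D M N : 'M[F]_n) (S T : 'cV[F]_n) :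
  D \in unitmx -> N \in unitmx -> M = D *m N -> S = D *m T ->
  M \in unitmx /\ invmx M *m S = invmx N *m T.
Proof.
move=> Du Nu -> ->; have DNu : D *m N \in unitmx by rewrite unitmx_mul Du.
split=> //; apply: (can_inj (mulKmx DNu)).
by rewrite mulKVmx// -mulmxA mulKVmx.
Qed.

Section Representatives.
Context {R : realType} {n : nat} {A : 'I_n -> {fset 'rV[R]_n}}.
Variables (rho : forall i, A i -> R) (f : forall i, {ffun A i -> R[i]}).
Hypothesis A_neq0 : forall i, A i != fset0.
Hypothesis rho_gt0 : forall i (a : A i), 0 < rho a.
Implicit Types (i : 'I_n) (x y z u : 'cV[R[i]]_n) (X Z : toric rho).

Lemma toric_eqP x y :
  reflect (\pi_(toric rho) x = \pi_(toric rho) y) (same_image rho x y).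
Proof. exact: eqmodP. Qed.

Lemma same_image_shift x y u : same_image rho x y -> same_image rho (x + u) (y + u).
Proof.
move=> /asboolP xy; apply/asboolP => i; have [l l0 h] := xy i.
exists l => // a; have := h a; rewrite !ffunE !rowcolDr !cexpD.
by rewrite !mulrA => ->.
Qed.

Section SameImage.
Variables x y : 'cV[R[i]]_n.
Hypothesis xy : same_image rho x y.

Lemma same_image_prob i (a : A i) : prob rho x a = prob rho y a.
Proof.
have /asboolP/(_ i)[l l0 h] := xy.
have w2 (b : A i) w : rho b ^+ 2 * expR (2 * complex.Re (rowcol (val b) w))
    = cabs (evalV rho i w b) ^+ 2.
  rewrite ffunE cabsM cabsR cabs_cexp exprMn real_normK ?num_real//.
  by rewrite -expRM_natl.
have l2 : cabs l ^+ 2 != 0 by rewrite expf_eq0 /= cabs_eq0.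
rewrite /prob /kernelK !w2; under eq_bigr do rewrite w2.
under [in RHS]eq_bigr do rewrite w2.
under eq_bigr do rewrite h cabsM exprMn.
by rewrite -mulr_sumr h cabsM exprMn -mulf_div divff ?mul1r.
Qed.

Lemma same_image_momentum i : momentum rho i x = momentum rho i y.
Proof. by apply: eq_bigr => a _; rewrite same_image_prob. Qed.

Lemma same_image_lnorm_i i u : lnorm_i rho i x u = lnorm_i rho i y u.
Proof.
rewrite !lnorm_iE /wnorm same_image_momentum.
by under eq_bigr do rewrite same_image_prob.
Qed.

Lemma same_image_lnorm u : lnorm rho x u = lnorm rho y u.
Proof.
have E : (fun i => lnorm_i rho i x u) = (fun i => lnorm_i rho i y u).
  by apply/funext => i; exact: same_image_lnorm_i.
exact: (congr1 (fun c : 'I_n -> R => Num.sqrt (\sum_i c i ^+ 2)) E).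
Qed.

(** Identified points have the same momenta and proportional evaluation vectors, so value and
    differential are rescaled row by row by the same scalars. These cancel in the Newton
    correction. *)
Lemma same_image_rows : exists2 s : 'I_n -> R[i], forall i, s i != 0 &
  newtonDS rho f x = diag_mx (\row_i s i) *m newtonDS rho f y /\
  newtonS rho f x 0 = diag_mx (\row_i s i) *m newtonS rho f y 0.
Proof.
have WE i : exists2 k : R[i], k != 0 &
    forall a, renormW rho x i x a = k * renormW rho y i y a.
  have /asboolP/(_ i)[l l0 h] := xy.
  exists (cexp (rowcol (momentum rho i y) (y - x)) * l) => [|a].
    by rewrite mulf_neq0 ?cexp_neq0.
  rewrite ![renormW _ _ _ _ _]ffunE h same_image_momentum rowcolBr.
  have K t : cexp t * cexp (- t) = 1 :> R[i] by rewrite -cexpD subrr cexp0.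
  rewrite cexpD -[LHS]mul1r -(K (rowcol (momentum rho i y) y)).
  by move: (cexp _) (cexp _) (cexp _) (evalV _ _ _ _) => c1 c2 c3 c4; ring.
have [k k0 kE] : exists2 k : 'I_n -> R[i], forall i, k i != 0 &
    forall i a, renormW rho x i x a = k i * renormW rho y i y a.
  have h i : {k : R[i] | k != 0 & forall a, renormW rho x i x a = k * renormW rho y i y a}.
    exact/cid2/WE.
  by exists (fun i => s2val (h i)) => i; case: (h i).
pose s i := (hnorm (renormW rho x i x))^-1%:C * k i * (hnorm (renormW rho y i y))%:C.
have W0 i w : (hnorm (renormW rho w i w))%:C != 0.
  by rewrite fmorph_eq0 hnorm_renormW_neq0.
exists s => [i|].
  by apply: mulf_neq0 (mulf_neq0 _ (k0 i)) (W0 _ _); rewrite fmorphV invr_eq0 W0.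
have rowE i (G : A i -> R[i]) :
    (hnorm (renormW rho x i x))^-1%:C * (\sum_a f i a * (renormW rho x i x a * G a))
    = s i * ((hnorm (renormW rho y i y))^-1%:C *
        (\sum_a f i a * (renormW rho y i y a * G a))).
  have -> : \sum_a f i a * (renormW rho x i x a * G a)
      = k i * \sum_a f i a * (renormW rho y i y a * G a).
    by rewrite mulr_sumr; apply: eq_bigr => a _; rewrite kE; ring.
  by rewrite /s !fmorphV; move: (\sum_a _) => t; field; rewrite !W0.
split.
  apply/matrixP => i j.
  have entry (M : 'M[R[i]]_n) : M i j = (M *m (delta_mx j 0 : 'cV[R[i]]_n)) i 0.
    by rewrite -colE mxE.
  have diagE (M : 'M[R[i]]_n) : (diag_mx (\row_i s i) *m M) i j = s i * M i j.
    by rewrite mul_diag_mx !mxE.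
  rewrite diagE.
  have Ex := etrans (entry _) (newtonDS_row rho f x _ i).
  have Ey := etrans (entry _) (newtonDS_row rho f y _ i).
  rewrite -(same_image_momentum i) in Ey.
  exact: etrans Ex (etrans (rowE i _) (congr1 (fun t => s i * t) (esym Ey))).
apply/colP => i.
have diagE (v : 'cV[R[i]]_n) : (diag_mx (\row_i s i) *m v) i 0 = s i * v i 0.
  by rewrite mul_diag_mx !mxE.
have SE w : newtonS rho f w 0 i 0 = (hnorm (renormW rho w i w))^-1%:C *
    (\sum_a f i a * (renormW rho w i w a * 1)).
  by rewrite mxE addr0; congr (_ * _); apply: eq_bigr => a _; rewrite mulr1.
rewrite diagE.
exact: etrans (SE x) (etrans (rowE i _) (congr1 (fun t => s i * t) (esym (SE y)))).
Qed.

Lemma same_image_newton : newtonDS rho f y \in unitmx ->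
  newtonDS rho f x \in unitmx /\
  \pi_(toric rho) (newton rho f x) = \pi_(toric rho) (newton rho f y).
Proof.
move=> DSy; have [s s0 [DSE SE]] := same_image_rows.
have Du : diag_mx (\row_i s i) \in unitmx.
  by rewrite unitmxE det_diag unitfE; apply/prodf_neq0 => i _; rewrite mxE.
have [DSx E] := rescaled_system Du DSy DSE SE.
split; first exact: DSx.
have shift (t t' : 'cV[R[i]]_n) : t = t' -> same_image rho (x - t) (y - t').
  by move=> ->; exact: same_image_shift.
apply/toric_eqP; exact: shift E.
Qed.

End SameImage.

Lemma toric_dist_le y z :
  toric_dist (\pi_(toric rho) y) (\pi_(toric rho) z) <= lnorm rho z (y - z).
Proof.
apply: ge_inf; last by exists y, z.
by exists 0 => _ [y' [z' [_ _ ->]]]; exact: lnorm_ge0.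
Qed.

(** A nearly minimizing pair may use another representative z' of the zero; translating the pair by
    z - z' restores [z] and changes neither the class of the first point nor the local norm. *)
Lemma toric_dist_adherent X z (e : R) : 0 < e -> exists2 y,
  \pi_(toric rho) y = X & lnorm rho z (y - z) < toric_dist X (\pi_(toric rho) z) + e.
Proof.
move=> e0.
have [|_ [y' [z' [y'X z'z ->]]] lt_e] := @inf_adherent _ [set r | exists y' z',
  [/\ \pi_(toric rho) y' = X, \pi_(toric rho) z' = \pi_(toric rho) z &
      r = lnorm rho z' (y' - z')]]%classic _ e0.
  split; last by exists 0 => _ [y' [z' [_ _ ->]]]; exact: lnorm_ge0.
  by exists (lnorm rho z (repr X - z)), (repr X), z; split=> //; rewrite reprK.
have zz' : same_image rho z z' by apply/toric_eqP.
exists (z + (y' - z')).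
  rewrite -y'X; apply/toric_eqP.
  by have := same_image_shift (y' - z') zz'; rewrite [z' + _]addrC subrK.
by rewrite [z + _]addrC addrK (same_image_lnorm zz').
Qed.

End Representatives.

(** * The doubly exponential rate and numerical slack *)

Section QuadraticRate.
Context {R : realType}.

Definition newton_rate (k : nat) : R := 2 ^ (- (2 ^ k)%N%:Z + 1).

Lemma newton_rate0 : newton_rate 0 = 1.
Proof. by rewrite /newton_rate expn0 addNr. Qed.

Lemma newton_rateS k : newton_rate k.+1 = newton_rate k ^+ 2 / 2.
Proof.
rewrite /newton_rate expnS mul2n -addnn PoszD opprD.
have two0 : (2 : R) != 0 by [].
by rewrite !expfzDr// expr1z; field.
Qed.

Lemma newton_rate_itv k : 0 < newton_rate k <= 1.
Proof.
elim: k => [|k /andP[k0 k1]]; first by rewrite newton_rate0 ltr01 lexx.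
rewrite newton_rateS divr_gt0 ?exprn_gt0//=.
rewrite ler_pdivrMr// mul1r (@le_trans _ _ 1) ?exprn_ile1 ?(ltW k0)//.
by rewrite ler1n.
Qed.

End QuadraticRate.

(** A strict bound at the infimum survives a small enlargement of the distance; the divisor K + 1
    covers K = 0. *)
Lemma linear_slack (R : realFieldType) (K D b : R) : 0 <= K -> K * D < b ->
  exists2 e1, 0 < e1 & forall e, 0 <= e <= e1 -> K * (D + e) <= b.
Proof.
move=> K0 KD; have K1 : 0 < K + 1 by rewrite ltr_wpDl.
exists ((b - K * D) / (K + 1)); first by rewrite divr_gt0// subr_gt0.
move=> e /andP[e0 ee1]; rewrite mulrDr -lerBrDl.
apply: (@le_trans _ _ ((K + 1) * e)); first by rewrite ler_wpM2r// lerDl.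
by rewrite mulrC -ler_pdivlMr.
Qed.

(** Since 2.745 * 0.182 < 1/2, one factor [c] comes from B and one from H, matching the recursion c
    -> c^2 / 2 of the rate. *)
Lemma half_square_bound (R : realFieldType) (B H c d : R) :
  0 <= H -> 0 <= c -> B <= c * (182 / 1000) -> H <= c * d ->
  2745 / 1000 * B * H <= c ^+ 2 / 2 * d.
Proof.
move=> H0 c0 Bc Hcd; apply: (@le_trans _ _ (c / 2 * H)).
  by apply: ler_wpM2r => //; lra.
apply: (@le_trans _ _ (c / 2 * (c * d))); first by apply: ler_wpM2l => //; lra.
by rewrite expr2 le_eqVlt; apply/orP; left; apply/eqP; ring.
Qed.

(** * The Newton sequence in the quotient *)

Section NewtonOrbit.
Context {R : realType} {n : nat} {A : 'I_n -> {fset 'rV[R]_n}}.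
Variables (rho : forall i, A i -> R) (f : forall i, {ffun A i -> R[i]}).
Hypothesis A_neq0 : forall i, A i != fset0.
Hypothesis rho_gt0 : forall i (a : A i), 0 < rho a.
Hypothesis n_gt0 : (0 < n)%N.
Hypothesis f_neq0 : forall i, f i != 0.
Variable z : 'cV[R[i]]_n.
Hypothesis z_zero : nondegenerate_zero rho f z.
Variable x0 : toric rho.

Local Notation K := (mu rho f z * nu rho z).
Local Notation dist0 := (toric_dist x0 (\pi_(toric rho) z)).

Definition newton_orbit (k : nat) : toric rho :=
  iter k (fun X : toric rho => \pi_(toric rho) (newton rho f (repr X))) x0.

Let K_ge0 : 0 <= K.
Proof.
by rewrite mulr_ge0 ?nu_ge0// (le_trans ler01)// mu_ge1.
Qed.

Lemma newton_orbitS (k : nat) y : newtonDS rho f y \in unitmx ->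
  \pi_(toric rho) y = newton_orbit k -> newton_step f (newton_orbit k) (newton_orbit k.+1).
Proof.
move=> DSy yk x' x'k.
have same w : \pi_(toric rho) w = newton_orbit k -> same_image rho w y.
  by move=> wk; apply/toric_eqP; rewrite wk yk.
have [DSx' Nx'] := same_image_newton A_neq0 rho_gt0 (same _ x'k) DSy.
have [_ Nr] := same_image_newton A_neq0 rho_gt0 (same _ (reprK _)) DSy.
split; first exact: DSx'.
have eq_via (X Y Z : toric rho) : X = Z -> Y = Z -> X = Y by move=> -> ->.
exact: eq_via Nx' (etrans (iterS _ _ _) Nr).
Qed.

(** The induction follows a lift of the orbit starting at [y0], because the representatives chosen
    by [repr] need not be close to [z]. *)
Lemma newton_orbit_contracts (d : R) y0 :
  K * d <= 182 / 1000 -> \pi_(toric rho) y0 = x0 -> lnorm rho z (y0 - z) <= d ->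
  forall k, exists2 y, \pi_(toric rho) y = newton_orbit k &
    newtonDS rho f y \in unitmx /\ lnorm rho z (y - z) <= newton_rate k * d.
Proof.
move=> Kd y0x0 y0d.
have d0 : 0 <= d := le_trans (lnorm_ge0 _ _ _) y0d.
have near y c : 0 <= c <= 1 -> lnorm rho z (y - z) <= c * d ->
    newtonDS rho f y \in unitmx /\
    lnorm rho z (newton rho f y - z) <= c ^+ 2 / 2 * d.
  move=> /andP[c0 c1] yd; set H := lnorm _ _ _ in yd.
  have H0 : 0 <= H := lnorm_ge0 _ _ _.
  have KH : K * H <= c * (182 / 1000).
    apply: (@le_trans _ _ (K * (c * d))); first by rewrite ler_wpM2l.
    by rewrite mulrCA ler_wpM2l.
  have c182 : c * (182 / 1000 : R) <= 182 / 1000 by lra.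
  have := newton_contraction A_neq0 rho_gt0 n_gt0 f_neq0 z_zero (h := y - z)
    (le_trans KH c182).
  rewrite [z + _]addrC subrK -/H => -[DSy le_new]; split; first exact: DSy.
  apply: le_trans le_new _.
  exact: half_square_bound.
elim=> [|k [y yk [DSy yd]]].
  have y0d1 : lnorm rho z (y0 - z) <= newton_rate 0 * d by rewrite newton_rate0 mul1r.
  exists y0 => //; split=> //.
  by have [] := near y0 (newton_rate 0) _ y0d1; rewrite newton_rate0 ?ler01 ?lexx.
have /andP[c0 c1] := newton_rate_itv (R := R) k.
have [|_ le_new] := near y (newton_rate k) _ yd; first by rewrite ltW.
rewrite -newton_rateS in le_new.
exists (newton rho f y).
  by have [] := newton_orbitS DSy yk yk.
have /andP[c0' c1'] := newton_rate_itv (R := R) k.+1.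
have [|DS' _] := near (newton rho f y) (newton_rate k.+1) _ le_new.
  by rewrite ltW.
by split.
Qed.

Lemma newton_orbit_converges : K * dist0 < 182 / 1000 -> forall k,
  newton_step f (newton_orbit k) (newton_orbit k.+1) /\
  toric_dist (newton_orbit k) (\pi_(toric rho) z) <= newton_rate k * dist0.
Proof.
move=> small k.
have approx (e : R) : 0 < e -> K * (dist0 + e) <= 182 / 1000 ->
    exists2 y, \pi_(toric rho) y = newton_orbit k &
      newtonDS rho f y \in unitmx /\
      lnorm rho z (y - z) <= newton_rate k * (dist0 + e).
  move=> e0 Ke; have [y0 y0x0 /ltW y0d] := toric_dist_adherent x0 z e0.
  exact: newton_orbit_contracts y0d k.
have [e1 e1_gt0 Ke] := linear_slack K_ge0 small.
split.
  have [|y yk [DSy _]] := approx _ e1_gt0; first by rewrite Ke// lexx ltW.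
  exact: newton_orbitS DSy yk.
apply/ler_addgt0Pr => e e0.
(* The enlargement must be at most [e] for the limit and at most [e1] for the contraction to
   apply. *)
have m0 : 0 < Num.min e e1 by rewrite lt_min e0.
have [|y yk [_ yd]] := approx _ m0.
  by rewrite Ke// ltW//= ge_min lexx orbT.
rewrite -yk; apply: le_trans (toric_dist_le rho y z) _.
apply: le_trans yd _; rewrite mulrDr lerD2l.
have /andP[c0 c1] := newton_rate_itv (R := R) k.
apply: (@le_trans _ _ (1 * Num.min e e1)); first by rewrite ler_wpM2r// ltW.
by rewrite mul1r ge_min lexx.
Qed.

End NewtonOrbit.

Theorem theorem3p6p2 (R : realType) :
  exists u0 : R,
    (90 / 10 ^+ 3 + 994 / 10 ^+ 6 + 609 / 10 ^+ 9 <= u0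
       < 90 / 10 ^+ 3 + 994 / 10 ^+ 6 + 610 / 10 ^+ 9) /\
    forall (n : nat) (A : 'I_n -> {fset 'rV[R]_n})
      (rho : forall i : 'I_n, A i -> R)
      (f : forall i : 'I_n, {ffun A i -> R[i]})
      (z : 'cV[R[i]]_n) (x0 : toric rho),
      (1 <= n)%N ->
      (forall i : 'I_n, A i != fset0) ->
      (forall (i : 'I_n) (a : A i), 0 < rho i a) ->
      (forall i : 'I_n, f i != 0) ->
      nondegenerate_zero rho f z ->
      1 / 2 * toric_dist x0 (\pi_(toric rho) z) * mu rho f z * nu rho z <= u0 ->
      exists x : nat -> toric rho,
        x 0%N = x0 /\
        forall i : nat,
          newton_step f (x i) (x i.+1) /\
          toric_dist (x i) (\pi_(toric rho) z)
            <= 2 ^ (- (2 ^ i)%N%:Z + 1) * toric_dist x0 (\pi_(toric rho) z).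
Proof.
(* The lower end of the window is chosen; its double 0.181989218 is below 0.182, which supplies the
   strict inequality needed for the passage to the infimum. *)
exists (90 / 10 ^+ 3 + 994 / 10 ^+ 6 + 609 / 10 ^+ 9).
have h9 : (10 : R) ^+ 9 = 10 ^+ 3 * 10 ^+ 3 * 10 ^+ 3 by rewrite -!exprD.
have h6 : (10 : R) ^+ 6 = 10 ^+ 3 * 10 ^+ 3 by rewrite -exprD.
have h3 : (10 : R) ^+ 3 = 1000 by rewrite -natrX.
split; first by rewrite h9 h6 h3; lra.
rewrite h9 h6 h3 => n A rho f z x0 n_gt0 A_neq0 rho_gt0 f_neq0 z_zero hyp.
have small : mu rho f z * nu rho z * toric_dist x0 (\pi_(toric rho) z) < 182 / 1000.
  move: hyp; rewrite -!mulrA [toric_dist _ _ * _]mulrC -mulrA.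
  by move: (mu _ _ _ * _) => t; lra.
exists (newton_orbit f x0); split; first by [].
exact: (newton_orbit_converges A_neq0 rho_gt0 n_gt0 f_neq0 z_zero small).
Qed.
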